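(* Let $R$ be an iterated local skew power series ring in the ordered list of variables $x_1,\dots,x_n$ of type $(A_\triangle)$ or $(B_\triangle)$ with residue field $k$, and fix a triangular monomial order $\preceq$ on $R$. Then the function $\mathrm{LM}=\mathrm{LM}_\preceq:R\to\mathbb{N}^n\cup\{\infty\}$ is a rank-$n$ ring filtration, and the associated graded ring is a $q$-commutative polynomial ring (i.e. a multiparameter quantum affine space) over $k$ in $n$ variables.
   Context: $\mathbb{N}$ contains $0$. A skew derivation on a ring $B$ is a pair $(\sigma,\delta)$ with $\sigma$ an automorphism of $B$ and $\delta:B\to B$ additive with $\delta(rs)=\delta(r)s+\sigma(r)\delta(s)$. If $(B,\mathfrak m)$ is a complete local ring, $(\sigma,\delta)$ is local if $\sigma(\mathfrak m^i)=\mathfrak m^i$ and $\delta(\mathfrak m^i)\subseteq\mathfrak m^{i+1}$ for all $i\ge 0$; then the skew power series ring $B[[x;\sigma,\delta]]$ exists: it is the left $B$-module of formal power series $\sum_j b_jx^j$ with the continuous multiplication extending $xr=\sigma(r)x+\delta(r)$ $(r\in B)$, and it is again complete local. If $A\subseteq B$ is a subring, $(\sigma,\delta)$ is $A$-linear if $\sigma(a)=a$ and $\delta(a)=0$ for all $a\in A$. The ring $R$ is one of the following. Case $(A_\triangle)$: $A=k$ is a finite field of characteristic $p$, $R_0=A$, and for $1\le i\le n$, $R_i=R_{i-1}[[x_i;\sigma_i,\delta_i]]$ with $(\sigma_i,\delta_i)$ a local, $A$-linear skew derivation on $R_{i-1}$ which is triangular, i.e. restricts to a skew derivation of $R_j$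 for every $0\le j\le i-1$. Put $R=R_n$. Case $(B_\triangle)$: $A$ is a (commutative) complete discrete valuation ring of characteristic $0$, not a field, with residue field $k$ a finite field of characteristic $p$; $x_1$ is a fixed uniformiser of $A$; $R_1=A$, and for $2\le i\le n$, $R_i=R_{i-1}[[x_i;\sigma_i,\delta_i]]$ with $(\sigma_i,\delta_i)$ a local, $A$-linear skew derivation on $R_{i-1}$ which is triangular, i.e. restricts to a skew derivation of $R_j$ for every $1\le j\le i-1$. Put $R=R_n$. Let $\iota:k\to A$ be the unique multiplicative section of $A\to k$ (the identity in the first case). For $\alpha\in\mathbb{N}^n$ write $x^\alpha=x_1^{\alpha_1}\cdots x_n^{\alpha_n}$. Every $r\in R$ is uniquely $r=\sum_{\alpha\in\mathbb{N}^n}r_\alpha x^\alpha$ with $r_\alpha\in\iota(k)$; $\mathrm{supp}(r)=\{\alpha:r_\alpha\ne0\}$. An additive total order on $\mathbb{N}^n$ is a total order with $0\prec\alpha$ for all $\alpha\neq 0$, and $\alpha\prec\beta\Rightarrow\alpha+\gamma\prec\beta+\gamma$ (automatically a well-order). For $r\ne0$, $\mathrm{LM}(r)=\min_\preceq\mathrm{supp}(r)$; $\mathrm{LM}(0)=\infty$, with $\alpha\prec\infty$ for all $\alpha$. A monomial order on $R$ is an additive total order with $\mathrm{LM}(x^\alpha x^\beta)=\alpha+\beta$ for all $\alpha,\beta\in\mathbb{N}^n$. Let $e_i$ be the $i$th standard basis vector of $\mathbb{Z}^n$, let $\mathcal S_n\subseteq\mathbb{Z}^n$ be the set of finite sums of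 elements $e_i-e_j$ with $i\le j$, and for $\alpha\in\mathbb{N}^n$ let $F(\alpha)=\bigcup_{\beta\in(\alpha+\mathcal S_n)\cap\mathbb{N}^n}(\beta+\mathbb{N}^n)$. Write $\alpha\le_F\beta$ if $\beta\in F(\alpha)$. The order $\preceq$ is triangular if $\alpha\le_F\beta$ implies $\alpha\preceq\beta$. ''Rank-$n$ ring filtration'' means: $\mathrm{LM}(r\pm s)\succeq\min\{\mathrm{LM}(r),\mathrm{LM}(s)\}$ and $\mathrm{LM}(rs)\succeq\mathrm{LM}(r)+\mathrm{LM}(s)$ for all $r,s\in R$, and $\mathrm{LM}(r)=\infty$ iff $r=0$. The associated graded ring is $\bigoplus_{\alpha\in\mathbb{N}^n}\{r:\mathrm{LM}(r)\succeq\alpha\}/\{r:\mathrm{LM}(r)\succ\alpha\}$ with the induced multiplication. A $q$-commutative polynomial ring over $k$ in $n$ variables is a ring $k\langle X_1,\dots,X_n\mid X_jX_i=q_{ij}X_iX_j,\ i<j\rangle$ for some $q_{ij}\in k^\times$. *)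

(* Defs.v *)
From HB Require Import structures.
From mathcomp Require Import all_boot all_order all_algebra.
From mathcomp Require Import boolp classical_sets.
From mathcomp.multinomials Require Import mpoly.
From mathcomp.multinomials Require monalg.

Set Implicit Arguments.
Unset Strict Implicit.
Unset Printing Implicit Defensive.

Import GRing.Theory.
Local Open Scope ring_scope.
Local Open Scope quotient_scope.
Local Open Scope classical_set_scope.

(* In a local ring the unique maximal ideal is the set of nonunits. *)
Definition max_ideal (B : unitRingType) : set B :=
  [set b | b \isn't a GRing.unit].

Fixpoint ideal_pow (B : pzRingType) (m : set B) (i : nat) : set B :=
  if i is j.+1 then
    [set b | exists l : seq (B * B),
       (forall ab, ab \in l -> m ab.1 /\ ideal_pow m j ab.2) /\
       b = \sum_(ab <- l) ab.1 * ab.2]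
  else setT.

(* The canonical map from B to the inverse limit of the B / m^i is bijective. *)
Definition adic_complete (B : pzRingType) (m : set B) : Prop :=
  (forall b, (forall i, ideal_pow m i b) -> b = 0) /\
  (forall u : nat -> B, (forall i, ideal_pow m i (u i.+1 - u i)) ->
     exists l, forall i, ideal_pow m i (l - u i)).

(* Unordered convergence of a family of elements of B to b, in the m-adic
   topology. *)
Definition adic_sum (B : pzRingType) (m : set B) (I : eqType) (u : I -> B)
    (b : B) : Prop :=
  forall N, exists s0 : seq I, forall s : seq I,
    uniq s -> {subset s0 <= s} -> ideal_pow m N (b - \sum_(i <- s) u i).

Definition is_dvr (A : idomainType) : Prop :=
  [/\ forall I : set A, I 0 -> (forall a b, I a -> I b -> I (a + b)) ->
        (forall c a, I a -> I (c * a)) ->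
        exists d, I = [set c * d | c in setT],
      forall a b : A, @max_ideal A a -> @max_ideal A b -> @max_ideal A (a + b)
    & exists a : A, a != 0 /\ @max_ideal A a].

Definition uniformiser (A : idomainType) (t : A) : Prop :=
  @max_ideal A = [set c * t | c in setT].

Definition skew_derivation (B : pzRingType) (sigma : {rmorphism B -> B})
    (delta : {additive B -> B}) : Prop :=
  bijective sigma /\
  forall r s, delta (r * s) = delta r * s + sigma r * delta s.

Definition local_skew (B : unitRingType) (sigma delta : B -> B) : Prop :=
  forall i, sigma @` ideal_pow (@max_ideal B) i = ideal_pow (@max_ideal B) i /\
    (delta @` ideal_pow (@max_ideal B) i `<=` ideal_pow (@max_ideal B) i.+1).

Definition linear_skew (A B : pzRingType) (a : A -> B) (sigma delta : B -> B) :
    Prop :=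
  forall c, sigma (a c) = a c /\ delta (a c) = 0.

Definition restricts_to (B : pzRingType) (sigma delta : B -> B) (T : set B) :
    Prop :=
  sigma @` T = T /\ (delta @` T `<=` T).

Definition series_close (B : unitRingType) (N : nat) (c c' : nat -> B) : Prop :=
  forall j, (j < N)%N -> ideal_pow (@max_ideal B) N (c j - c' j).

(* S = B[[x; sigma, delta]]: the coefficient map identifies the left B-module S
   with the formal power series over B, the multiplication extends
   x r = sigma(r) x + delta(r), and it is jointly continuous for the product
   topology on power series, B carrying the adic topology of its maximal
   ideal. *)
Record skew_power_series_ring (B S : unitRingType) (sigma delta : B -> B)
    (inc : {rmorphism B -> S}) (x : S) (coef : S -> nat -> B) : Prop := {
  spsr_inj : forall s t, coef s =1 coef t -> s = t;
  spsr_surj : forall c : nat -> B, exists s, coef s =1 c;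
  spsr_add : forall s t j, coef (s + t) j = coef s j + coef t j;
  spsr_scale : forall b s j, coef (inc b * s) j = b * coef s j;
  spsr_pow : forall i j, coef (x ^+ i) j = (i == j)%:R;
  spsr_comm : forall r, x * inc r = inc (sigma r) * x + inc (delta r);
  spsr_cont : forall s t N, exists M, forall s' t',
    series_close M (coef s') (coef s) -> series_close M (coef t') (coef t) ->
    series_close N (coef (s' * t')) (coef (s * t))
}.

(* The possible rings A, with the multiplicative section iota : k -> A and the
   list of those variables which already belong to A: none if A = k is a
   finite field; a uniformiser if A is a complete discrete valuation ring of
   characteristic 0 with residue field k. *)
Inductive coefficient_ring (p : nat) (k : finFieldType) :
    forall A : unitRingType, (k -> A) -> seq A -> Prop :=
| CoefField of p \in [pchar k] : @coefficient_ring p k k id [::]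
| CoefDVR (A : idomainType) (red : {rmorphism A -> k}) (iota : k -> A) (t : A)
    of p \in [pchar k]
     & is_dvr A
     & adic_complete (@max_ideal A)
     & [pchar A] =i pred0
     & (forall c, exists a, red a = c)
     & (forall a, red a = 0 <-> @max_ideal A a)
     & uniformiser t
     & cancel iota red
     & {morph iota : c d / c * d} :
    @coefficient_ring p k A iota [:: t].

(* iterated_skew x0 a subs xs: R is obtained from A by successively adjoining
   variables by local, A-linear, triangular skew derivations.  Here a : A -> R
   is the structure map, xs lists the variables, starting with the variables
   x0 of A, and subs lists the subrings A, ..., R_{i-1}, R_i = R. *)
Inductive iterated_skew (A : unitRingType) (x0 : seq A) :
    forall R : unitRingType, {rmorphism A -> R} -> seq (set R) -> seq R -> Prop :=
| IterBase : @iterated_skew A x0 A idfun [:: setT] x0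
| IterStep (B S : unitRingType) (a : {rmorphism A -> B}) (subs : seq (set B))
    (xs : seq B) (sigma : {rmorphism B -> B}) (delta : {additive B -> B})
    (inc : {rmorphism B -> S}) (x : S) (coef : S -> nat -> B)
    of @iterated_skew A x0 B a subs xs
     & skew_derivation sigma delta
     & local_skew sigma delta
     & linear_skew a sigma delta
     & (forall j, (j < size subs)%N -> restricts_to sigma delta (nth setT subs j))
     & skew_power_series_ring sigma delta inc x coef :
    @iterated_skew A x0 S (inc \o a)
      (rcons [seq inc @` T | T <- subs] setT) (rcons [seq inc b | b <- xs] x).

Definition mon (R : pzRingType) (n : nat) (x : n.-tuple R) (al : 'X_{1..n}) : R :=
  \prod_(i < n) tnth x i ^+ al i.

Section Expansion.
Variables (k : finFieldType) (A R : unitRingType) (iota : k -> A).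
Variables (a : {rmorphism A -> R}) (n : nat) (x : n.-tuple R).

Definition expansion (r : R) (c : 'X_{1..n} -> A) : Prop :=
  (forall al, range iota (c al)) /\
  adic_sum (@max_ideal R) (fun al => a (c al) * mon x al) r.

(* The coefficients r_alpha; the expansion of r exists and is unique when R is
   an iterated local skew power series ring. *)
Definition coefs (r : R) : 'X_{1..n} -> A :=
  xget (fun _ => 0) [set c | expansion r c].

Definition supp (r : R) : set 'X_{1..n} := [set al | coefs r al != 0].

End Expansion.

Record additive_total_order (n : nat) (ord : rel 'X_{1..n}) : Prop := {
  ato_refl : reflexive ord;
  ato_anti : antisymmetric ord;
  ato_trans : transitive ord;
  ato_total : total ord;
  ato_min : forall al, al != 0%MM -> ord 0%MM al && (0%MM != al);
  ato_add : forall al be ga, ord al be && (al != be) ->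
    ord (al + ga)%MM (be + ga)%MM && ((al + ga)%MM != (be + ga)%MM)
}.

(* None stands for the element infinity. *)
Definition ole (n : nat) (ord : rel 'X_{1..n}) : rel (option 'X_{1..n}) :=
  fun u v => match u, v with
  | _, None => true
  | None, Some _ => false
  | Some al, Some be => ord al be
  end.

Definition olt n (ord : rel 'X_{1..n}) : rel (option 'X_{1..n}) :=
  fun u v => ole ord u v && (u != v).

Definition omin n (ord : rel 'X_{1..n}) (u v : option 'X_{1..n}) :=
  if ole ord u v then u else v.

Definition oadd n (u v : option 'X_{1..n}) : option 'X_{1..n} :=
  if u is Some al then if v is Some be then Some (al + be)%MM else None
  else None.

Definition leading_monomial (R : pzRingType) n (ord : rel 'X_{1..n})
    (supp : R -> set 'X_{1..n}) (r : R) : option 'X_{1..n} :=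
  if r == 0 then None
  else Some (xget 0%MM
    [set al | supp r al /\ forall be, supp r be -> ord al be]).

Record monomial_order (R : pzRingType) n (x : n.-tuple R)
    (supp : R -> set 'X_{1..n}) (ord : rel 'X_{1..n}) : Prop := {
  mo_order : additive_total_order ord;
  mo_mul : forall al be, leading_monomial ord supp (mon x al * mon x be) =
    Some (al + be)%MM
}.

(* The subset S_n of Z^n; e_i is delta_mx 0 i. *)
Definition tri_shift n : set 'rV[int]_n :=
  [set v | exists l : seq ('I_n * 'I_n), all (fun ij : 'I_n * 'I_n => (ij.1 <= ij.2)%N) l /\
    v = \sum_(ij <- l) (delta_mx 0 ij.1 - delta_mx 0 ij.2)].

Definition mnm_row n (al : 'X_{1..n}) : 'rV[int]_n := \row_i (al i)%:Z.

(* tri_cone al is F(al), so that tri_cone al be means al <=_F be. *)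
Definition tri_cone n (al : 'X_{1..n}) : set 'X_{1..n} :=
  [set ga | exists be : 'X_{1..n},
    @tri_shift n (mnm_row be - mnm_row al) /\ exists ep, ga = (be + ep)%MM].

Definition triangular_order n (ord : rel 'X_{1..n}) : Prop :=
  forall al be, tri_cone al be -> ord al be.

Record ring_filtration (R : pzRingType) n (ord : rel 'X_{1..n})
    (v : R -> option 'X_{1..n}) : Prop := {
  rf_add : forall r s, ole ord (omin ord (v r) (v s)) (v (r + s));
  rf_sub : forall r s, ole ord (omin ord (v r) (v s)) (v (r - s));
  rf_mul : forall r s, ole ord (oadd (v r) (v s)) (v (r * s));
  rf_infty : forall r, v r = None <-> r = 0
}.

Record two_sided_ideal (T : pzRingType) (I : set T) : Prop := {
  tsi0 : I 0;
  tsiB : forall x y, I x -> I y -> I (x - y);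
  tsiMl : forall a x, I x -> I (a * x);
  tsiMr : forall a x, I x -> I (x * a)
}.

Section QuotRing.
Variables (T : pzRingType) (I : set T) (HI : two_sided_ideal I).

Definition quot_eqv (x y : T) : bool := `[< I (x - y) >].

Lemma quot_eqv_equiv : equiv_class_of quot_eqv.
Proof.
split=> [x|x y|y x z].
- by apply/asboolP; rewrite subrr; exact: tsi0 HI.
- have H u v : quot_eqv u v -> quot_eqv v u.
    move/asboolP => h; apply/asboolP; rewrite -opprB -sub0r.
    by apply: (tsiB HI) => //; exact: tsi0 HI.
  by apply/idP/idP; exact: H.
move=> /asboolP h1 /asboolP h2; apply/asboolP.
have -> : x - z = (x - y) - (0 - (y - z)).
  by rewrite sub0r opprK addrA subrK.
by apply: (tsiB HI) => //; apply: (tsiB HI) => //; exact: tsi0 HI.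
Qed.

Canonical quot_eqv_canon := EquivRelPack quot_eqv_equiv.
Canonical quot_eqv_encModRel := defaultEncModRel quot_eqv.

Definition quot_ring := {eq_quot quot_eqv}.
HB.instance Definition _ : EqQuotient T quot_eqv quot_ring :=
  EqQuotient.on quot_ring.
HB.instance Definition _ := Choice.on quot_ring.

Definition quot_pi (x : T) : quot_ring := \pi x.

Lemma quot_piE x y : quot_pi x = quot_pi y <-> I (x - y).
Proof.
split=> [/eqP|h]; last by apply/eqP; rewrite piE; apply/asboolP.
by rewrite piE => /asboolP.
Qed.

Lemma quot_repr x : I (repr (quot_pi x) - x).
Proof. by apply/quot_piE; rewrite /quot_pi reprK. Qed.

Lemma quot_piK u : quot_pi (repr u) = u.
Proof. exact: reprK. Qed.

Definition qzero : quot_ring := quot_pi 0.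
Definition qone : quot_ring := quot_pi 1.
Definition qopp (u : quot_ring) : quot_ring := quot_pi (- repr u).
Definition qadd (u v : quot_ring) : quot_ring := quot_pi (repr u + repr v).
Definition qmul (u v : quot_ring) : quot_ring := quot_pi (repr u * repr v).

Let tsiN x : I x -> I (- x).
Proof. by move=> h; rewrite -sub0r; apply: (tsiB HI) => //; exact: tsi0 HI. Qed.
Let tsiD x y : I x -> I y -> I (x + y).
Proof. by move=> h /tsiN h'; rewrite -[y]opprK; exact: (tsiB HI). Qed.

Lemma quot_piN x : qopp (quot_pi x) = quot_pi (- x).
Proof.
by apply/quot_piE; rewrite opprK addrC -opprB; apply: tsiN; exact: quot_repr.
Qed.

Lemma quot_piD x y : qadd (quot_pi x) (quot_pi y) = quot_pi (x + y).
Proof.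
by apply/quot_piE; rewrite opprD addrACA; apply: tsiD; exact: quot_repr.
Qed.

Lemma quot_piM x y : qmul (quot_pi x) (quot_pi y) = quot_pi (x * y).
Proof.
apply/quot_piE.
set u := repr _; set v := repr _.
have -> : u * v - x * y = (u - x) * v + x * (v - y).
  by rewrite mulrBl mulrBr addrA subrK.
by apply: tsiD; [apply: (tsiMr HI)|apply: (tsiMl HI)]; exact: quot_repr.
Qed.

Lemma qaddA : associative qadd.
Proof.
move=> u v w; rewrite -[u]quot_piK -[v]quot_piK -[w]quot_piK.
by rewrite !quot_piD addrA.
Qed.

Lemma qaddC : commutative qadd.
Proof. by move=> u v; rewrite /qadd addrC. Qed.

Lemma qadd0 : left_id qzero qadd.
Proof. by move=> u; rewrite -[u]quot_piK quot_piD add0r. Qed.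

Lemma qaddN : left_inverse qzero qopp qadd.
Proof. by move=> u; rewrite -[u]quot_piK quot_piN quot_piD addNr. Qed.

Lemma qmulA : associative qmul.
Proof.
move=> u v w; rewrite -[u]quot_piK -[v]quot_piK -[w]quot_piK.
by rewrite !quot_piM mulrA.
Qed.

Lemma qmul1l : left_id qone qmul.
Proof. by move=> u; rewrite -[u]quot_piK quot_piM mul1r. Qed.

Lemma qmul1r : right_id qone qmul.
Proof. by move=> u; rewrite -[u]quot_piK quot_piM mulr1. Qed.

Lemma qmulDl : left_distributive qmul qadd.
Proof.
move=> u v w; rewrite -[u]quot_piK -[v]quot_piK -[w]quot_piK.
by rewrite !(quot_piM, quot_piD) mulrDl.
Qed.

Lemma qmulDr : right_distributive qmul qadd.
Proof.
move=> u v w; rewrite -[u]quot_piK -[v]quot_piK -[w]quot_piK.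
by rewrite !(quot_piM, quot_piD) mulrDr.
Qed.

HB.instance Definition _ :=
  GRing.isZmodule.Build quot_ring qaddA qaddC qadd0 qaddN.
HB.instance Definition _ := GRing.Zmodule_isPzRing.Build quot_ring
  qmulA qmul1l qmul1r qmulDl qmulDr.

Lemma quot_pi_is_additive : zmod_morphism quot_pi.
Proof. by move=> x y; rewrite -quot_piD -quot_piN. Qed.

Lemma quot_pi_is_multiplicative : monoid_morphism quot_pi.
Proof. by split=> // x y; rewrite -quot_piM. Qed.

HB.instance Definition _ :=
  GRing.isZmodMorphism.Build T quot_ring quot_pi quot_pi_is_additive.
HB.instance Definition _ :=
  GRing.isMonoidMorphism.Build T quot_ring quot_pi quot_pi_is_multiplicative.

End QuotRing.

(* Families F_al, F_al^+ of subgroups of R for which the direct sum of the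
   quotients F_al / F_al^+ inherits a multiplication from R. *)
Record graded_family (R : pzRingType) n (F Fp : 'X_{1..n} -> set R) : Prop := {
  gf1 : F 0%MM 1;
  gf0 : forall al, Fp al 0;
  gfB : forall al r s, F al r -> F al s -> F al (r - s);
  gfpB : forall al r s, Fp al r -> Fp al s -> Fp al (r - s);
  gf_sub : forall al, (Fp al `<=` F al);
  gfM : forall al be r s, F al r -> F be s -> F (al + be)%MM (r * s);
  gfpMl : forall al be r s, F al r -> Fp be s -> Fp (al + be)%MM (r * s);
  gfpMr : forall al be r s, Fp al r -> F be s -> Fp (al + be)%MM (r * s)
}.

(* The direct sum of the F_al is realised as the ring of those polynomials
   over R, in central variables, whose coefficient in degree al lies in F_al
   for all al; the associated graded ring is its quotient by the polynomials
   whose coefficient in degree al lies in F_al^+ for all al. *)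
Section AssocGraded.
Variables (R : nzRingType) (n : nat) (F Fp : 'X_{1..n} -> set R).
Variable HF : graded_family F Fp.

Definition rees_pred of graded_family F Fp : pred {mpoly R[n]} :=
  fun f => `[< forall al, F al f@_al >].

Let F0 al : F al 0. Proof. exact/(gf_sub HF)/(gf0 HF). Qed.
Let FD al r s : F al r -> F al s -> F al (r + s).
Proof.
move=> h h'; rewrite -[s]opprK -[- s]sub0r.
by apply: (gfB HF) => //; apply: (gfB HF).
Qed.
Let FpD al r s : Fp al r -> Fp al s -> Fp al (r + s).
Proof.
move=> h h'; rewrite -[s]opprK -[- s]sub0r.
by apply: (gfpB HF) => //; apply: (gfpB HF) => //; exact: (gf0 HF).
Qed.

Lemma rees_closed : subring_closed (rees_pred HF).
Proof.
split=> [|f g /asboolP hf /asboolP hg|f g /asboolP hf /asboolP hg];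
  apply/asboolP => al.
- rewrite mcoeff1; case: eqP => [->|_] /=; [exact: (gf1 HF)|exact: F0].
- by rewrite mcoeffB; apply: (gfB HF).
- rewrite mcoeffM; apply: (@big_ind _ (F al)) => [||[u v] /= /eqP e]; first exact: F0.
    exact: FD.
  by rewrite [X in F X]e; exact: (gfM HF).
Qed.

Record rees_ring := Rees { rees_val : {mpoly R[n]}; _ : rees_val \in rees_pred HF }.

HB.instance Definition _ := [isSub for rees_val].
HB.instance Definition _ := [Choice of rees_ring by <:].
HB.instance Definition _ := GRing.SubChoice_isSubPzRing.Build {mpoly R[n]}
  (rees_pred HF) rees_ring rees_closed.

Definition rees_ideal : set rees_ring :=
  [set f | forall al, Fp al (rees_val f)@_al].

Lemma rees_ideal_ideal : two_sided_ideal rees_ideal.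
Proof.
have valF (f : rees_ring) al : F al (rees_val f)@_al by case: f => f /= /asboolP.
split=> [al|f g hf hg al|f g hg al|f g hg al].
- by rewrite (raddf0 (val : rees_ring -> _) : rees_val 0 = 0) mcoeff0; exact: (gf0 HF).
- rewrite (raddfB (val : rees_ring -> _) f g : rees_val (f - g) = _) mcoeffB.
  exact: (gfpB HF).
- rewrite (rmorphM (val : rees_ring -> _) f g : rees_val (f * g) = _) mcoeffM.
  apply: (@big_ind _ (Fp al)) => [||[u v] /= /eqP e]; first exact: (gf0 HF).
    exact: FpD.
  by rewrite [X in Fp X]e; apply: (gfpMl HF).
- rewrite (rmorphM (val : rees_ring -> _) g f : rees_val (g * f) = _) mcoeffM.
  apply: (@big_ind _ (Fp al)) => [||[u v] /= /eqP e]; first exact: (gf0 HF).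
    exact: FpD.
  by rewrite [X in Fp X]e; apply: (gfpMr HF).
Qed.

Definition gr_of_family := quot_ring rees_ideal_ideal.
HB.instance Definition _ := GRing.PzRing.on gr_of_family.

End AssocGraded.

Section FiltrationFamily.
Variables (R : pzRingType) (n : nat) (ord : rel 'X_{1..n}).
Variable v : R -> option 'X_{1..n}.

Definition fil_ge al : set R := [set r | ole ord (Some al) (v r)].
Definition fil_gt al : set R := [set r | olt ord (Some al) (v r)].

Hypotheses (Hord : additive_total_order ord) (Hv : ring_filtration ord v).

Let ole_trans : transitive (ole ord).
Proof. by move=> [b|] [a|] [c|] //=; exact: (ato_trans Hord). Qed.

Let olt_le_trans a b c : olt ord a b -> ole ord b c -> olt ord a c.
Proof.
move=> /andP[ab ne] bc; apply/andP; split; first exact: ole_trans bc.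
apply: contraNneq ne => e; move: bc ab; rewrite -e {c e}.
case: a b => [a|] [b|] //= h1 h2.
by apply/eqP; congr Some; apply: (ato_anti Hord); rewrite h1 h2.
Qed.

Let ole_lt_trans a b c : ole ord a b -> olt ord b c -> olt ord a c.
Proof.
move=> ab /andP[bc ne]; apply/andP; split; first exact: ole_trans bc.
apply: contraNneq ne => e; move: bc ab; rewrite -e {c e}.
case: a b => [a|] [b|] //= h1 h2.
by apply/eqP; congr Some; apply: (ato_anti Hord); rewrite h1 h2.
Qed.

Let leD1 a b c : ord a b -> ord (a + c)%MM (b + c)%MM.
Proof.
move=> h; have [->|ne] := eqVneq a b; first exact: (ato_refl Hord).
by have /andP[] := @ato_add _ _ Hord a b c (introT andP (conj h ne)).
Qed.

Let ltD1 a b c : olt ord (Some a) (Some b) ->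
  olt ord (Some (a + c)%MM) (Some (b + c)%MM).
Proof.
move=> /andP[/= h ne].
have := @ato_add _ _ Hord a b c (introT andP (conj h ne)).
by move=> /andP[h1 h2]; apply/andP.
Qed.

Let omin_ind (P : option 'X_{1..n} -> Prop) a b : P a -> P b -> P (omin ord a b).
Proof. by rewrite /omin; case: ifP. Qed.

Lemma filtration_family : graded_family fil_ge fil_gt.
Proof.
have v0 : v 0 = None by apply/(rf_infty Hv).
split.
- rewrite /fil_ge /=; case: (v 1) => //= b.
  have [->|/(ato_min Hord)/andP[]//] := eqVneq b 0%MM; exact: (ato_refl Hord).
- by move=> al; rewrite /fil_gt /= v0.
- move=> al r s h h'; apply: ole_trans (rf_sub Hv r s).
  by apply: (omin_ind (P := fun u => ole ord (Some al) u)).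
- move=> al r s h h'; apply: olt_le_trans (rf_sub Hv r s).
  by apply: (omin_ind (P := fun u => olt ord (Some al) u)).
- by move=> al r /andP[].
- move=> al be r s h h'; apply: ole_trans (rf_mul Hv r s).
  move: h h'; rewrite /fil_ge /=; case: (v r) (v s) => [a|] [b|] //= h1 h2.
  apply: (@ato_trans _ _ Hord (a + be)%MM); first exact: leD1.
  by rewrite ![(a + _)%MM]addmC; exact: leD1.
- move=> al be r s h h'; apply: olt_le_trans (rf_mul Hv r s).
  move: h h'; rewrite /fil_ge /fil_gt /=; case: (v r) (v s) => [a|] [b|] //= h1 h2.
  apply: (@ole_lt_trans _ (Some (a + be)%MM)); first exact: leD1.
  by rewrite ![(a + _)%MM]addmC; exact: ltD1.
- move=> al be r s h h'; apply: olt_le_trans (rf_mul Hv r s).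
  move: h h'; rewrite /fil_ge /fil_gt /=; case: (v r) (v s) => [a|] [b|] //= h1 h2.
  apply: (@olt_le_trans _ (Some (a + be)%MM)); first exact: ltD1.
  by rewrite /= ![(a + _)%MM]addmC; exact: leD1.
Qed.

End FiltrationFamily.

Definition assoc_graded (R : nzRingType) n (ord : rel 'X_{1..n})
    (v : R -> option 'X_{1..n}) (Hord : additive_total_order ord)
    (Hv : ring_filtration ord v) :=
  gr_of_family (filtration_family Hord Hv).

HB.instance Definition _ (R : nzRingType) n (ord : rel 'X_{1..n})
    (v : R -> option 'X_{1..n}) (Hord : additive_total_order ord)
    (Hv : ring_filtration ord v) :=
  GRing.PzRing.on (assoc_graded Hord Hv).

Definition ideal_gen (T : pzRingType) (rels : set T) : set T :=
  [set t | forall J : set T, two_sided_ideal J -> (rels `<=` J) -> J t].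

Lemma ideal_gen_ideal (T : pzRingType) (rels : set T) :
  two_sided_ideal (ideal_gen rels).
Proof.
split=> [J HJ _|x y hx hy J HJ hJ|a x hx J HJ hJ|a x hx J HJ hJ].
- exact: tsi0 HJ.
- by apply: (tsiB HJ); [exact: hx|exact: hy].
- by apply: (tsiMl HJ); exact: hx.
- by apply: (tsiMr HJ); exact: hx.
Qed.

Section QComm.
Import monalg.
Variables (k : fieldType) (n : nat) (q : 'I_n -> 'I_n -> k).

Definition free_alg := {malg k[{fmonom 'I_n}]}.
HB.instance Definition _ := GRing.Lalgebra.on free_alg.

Definition free_var (i : 'I_n) : free_alg := << fmu i >>.

Definition qcomm_rels : set free_alg :=
  [set t | exists i j : 'I_n, (i < j)%N /\
    t = free_var j * free_var i - q i j *: (free_var i * free_var j)].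

Definition qcomm_poly := quot_ring (ideal_gen_ideal qcomm_rels).
HB.instance Definition _ := GRing.PzRing.on qcomm_poly.

End QComm.

(* Main.v *)
Require Import Defs.
From HB Require Import structures.
From mathcomp Require Import all_boot all_order all_algebra.
From mathcomp Require Import boolp classical_sets.
From mathcomp.multinomials Require Import mpoly.
From mathcomp.multinomials Require monalg.
From mathcomp Require finmap.

Import GRing.Theory.
Local Open Scope ring_scope.

(* Let m be the maximal ideal of R. By induction on the number of variables, the
   m-adic filtration of B[[x; sigma, delta]] is read off the coefficients (x and
   m_B having degree 1), so the monomials of degree N form a k-basis of
   m^N / m^(N+1). This gives existence and uniqueness of the expansions, and shows
   that for every U closed under adding exponents, the elements supported in U
   are exactly the closure of the A-span of the x^al with al in U.  For
   U = {be | al <= be} the latter description is visibly additive, and it is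
   multiplicative because LM (x^al x^be) = al + be.  Hence LM is a filtration whose
   graded pieces are the lines k x^al.  Finally the free algebra maps onto the
   graded ring, q_ij being the leading coefficient of x_j x_i, and the map is
   injective modulo the q-relations, since these rewrite every word into an
   ordered monomial and the images of the ordered monomials are independent. *)

Set Implicit Arguments.
Unset Strict Implicit.
Unset Printing Implicit Defensive.

(** The obstacle when [A] is a valuation ring is that [iota] is multiplicative but not additive, so
    adding two expansions produces carries. A carry is a coefficient in the maximal ideal of [A]; it
    is a multiple of the uniformiser, which is itself the first variable. So a carry moves the
    exponent al to al + e_1: it stays in every U closed under adding exponents, and its degree
    grows, so that removing carries one degree after another converges m-adically. (If [A] is a
    field, carries are zero.) Since al + e_1 lies strictly above al, carries also vanish in the
    graded ring, where [iota] becomes additive. A second obstacle is that the order need not be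
    compatible with the degree: in lexicographic orders infinitely many exponents may precede a
    given one. A bound on LM is then not a condition modulo a power of m, only a closed condition,
    which is why spans are closed up m-adically. For the same reason least exponents cannot be found
    by bounding the degree; they come from Dickson's lemma. *)

Section TwoSidedIdeal.
Variables (B : pzRingType) (I : set B).
Hypothesis HI : two_sided_ideal I.

Lemma tsiN b : I b -> I (- b).
Proof. by move=> hb; rewrite -sub0r; apply: (tsiB HI) => //; exact: tsi0 HI. Qed.

Lemma tsiD b c : I b -> I c -> I (b + c).
Proof. by move=> hb /tsiN hc; rewrite -[c]opprK; exact: (tsiB HI). Qed.

Lemma tsi_sum (K : Type) (r : seq K) (P : pred K) (f : K -> B) :
  (forall i, P i -> I (f i)) -> I (\sum_(i <- r | P i) f i).
Proof. by move=> h; apply: (@big_ind _ I) => //; [exact: tsi0 HI|exact: tsiD]. Qed.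

Lemma tsi_sum_seq (K : eqType) (r : seq K) (f : K -> B) :
  (forall i, i \in r -> I (f i)) -> I (\sum_(i <- r) f i).
Proof. by move=> h; rewrite big_seq; apply: tsi_sum. Qed.

Lemma tsiBl b c : I (b - c) -> I c -> I b.
Proof. by move=> h hc; rewrite -[b](subrK c); exact: tsiD. Qed.

Lemma tsiBC b c : I (b - c) -> I (c - b).
Proof. by move=> h; rewrite -opprB; exact: tsiN. Qed.

Lemma tsi_trans b c d : I (b - c) -> I (c - d) -> I (b - d).
Proof. by move=> h h'; rewrite -[b](subrK c) -addrA; exact: tsiD. Qed.

End TwoSidedIdeal.

(** * Powers of a two-sided ideal *)

Section IdealPow.
Variables (B : pzRingType) (m : set B).
Hypothesis Hm : two_sided_ideal m.

Lemma ideal_pow_ideal i : two_sided_ideal (ideal_pow m i).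
Proof.
elim: i => [|i IHi]; first by split.
split.
- by exists [::]; split=> //; rewrite big_nil.
- move=> _ _ [l [hl ->]] [l' [hl' ->]].
  exists (l ++ [seq (- ab.1, ab.2) | ab <- l']); split.
    move=> ab; rewrite mem_cat => /orP[/hl//|/mapP[cd /hl'[h1 h2] ->]] /=.
    by split=> //; exact: tsiN.
  rewrite big_cat big_map -sumrN; congr (_ + _).
  by apply: eq_bigr => ab _; rewrite mulNr.
- move=> c _ [l [hl ->]]; exists [seq (c * ab.1, ab.2) | ab <- l]; split.
    by move=> _ /mapP[cd /hl[h1 h2] ->] /=; split=> //; exact: (tsiMl Hm).
  by rewrite big_map mulr_sumr; apply: eq_bigr => ab _; rewrite mulrA.
- move=> c _ [l [hl ->]]; exists [seq (ab.1, ab.2 * c) | ab <- l]; split.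
    by move=> _ /mapP[cd /hl[h1 h2] ->] /=; split=> //; exact: (tsiMr IHi).
  by rewrite big_map mulr_suml; apply: eq_bigr => ab _; rewrite mulrA.
Qed.

Lemma ideal_powW i j b : (i <= j)%N -> ideal_pow m j b -> ideal_pow m i b.
Proof.
move=> /subnK <-; elim: (j - i)%N => [//|l IH] hb; apply: IH.
move: hb => [s [hs ->]]; apply: (tsi_sum_seq (ideal_pow_ideal _)) => ab /hs[_].
exact: (tsiMl (ideal_pow_ideal _)).
Qed.

Lemma ideal_powSM j b c : m b -> ideal_pow m j c -> ideal_pow m j.+1 (b * c).
Proof.
move=> hb hc; exists [:: (b, c)]; split; last by rewrite big_seq1.
by move=> bc; rewrite inE => /eqP ->.
Qed.

Lemma ideal_powM i j b c :
  ideal_pow m i b -> ideal_pow m j c -> ideal_pow m (i + j) (b * c).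
Proof.
elim: i b => [|i IHi] b hb hc; first exact: (tsiMl (ideal_pow_ideal _)).
move: hb => [l [hl ->]]; rewrite mulr_suml.
apply: (tsi_sum_seq (ideal_pow_ideal (i.+1 + j))) => ab /hl[h1 h2].
by rewrite -mulrA; apply: ideal_powSM => //; exact: IHi.
Qed.

Lemma ideal_pow1 b : ideal_pow m 1 b <-> m b.
Proof.
split=> [[l [hl ->]]|hb]; last by rewrite -[b]mulr1; exact: ideal_powSM.
by apply: (tsi_sum_seq Hm) => ab /hl[h _]; exact: (tsiMr Hm).
Qed.

Lemma ideal_powX b i : m b -> ideal_pow m i (b ^+ i).
Proof. by move=> hb; elim: i => [//|i IHi]; rewrite exprS; exact: ideal_powSM. Qed.

End IdealPow.

(** * Skew power series rings *)

Section SkewPowerSeries.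
Variables (B S : unitRingType) (sigma delta : B -> B).
Variables (inc : {rmorphism B -> S}) (x : S) (coef : S -> nat -> B).
Hypothesis H : skew_power_series_ring sigma delta inc x coef.
Let mB := @max_ideal B.
Hypothesis Hm : two_sided_ideal mB.
Hypothesis Hc : adic_complete mB.
Hypothesis Hl : local_skew sigma delta.

Lemma spsr_coef0 j : coef 0 j = 0.
Proof. by apply: (addrI (coef 0 j)); rewrite -(spsr_add H) !addr0. Qed.

Lemma spsr_coefN s j : coef (- s) j = - coef s j.
Proof. by apply/eqP; rewrite -addr_eq0 -(spsr_add H) addNr spsr_coef0. Qed.

Lemma spsr_coefB s t j : coef (s - t) j = coef s j - coef t j.
Proof. by rewrite (spsr_add H) spsr_coefN. Qed.

Lemma spsr_coef_sum (K : Type) (r : seq K) (P : pred K) (f : K -> S) j :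
  coef (\sum_(i <- r | P i) f i) j = \sum_(i <- r | P i) coef (f i) j.
Proof.
by elim/big_ind2: _ => [|s b s' b' <- <-|//]; [exact: spsr_coef0|exact: (spsr_add H)].
Qed.

Lemma spsr_coef_monomial b i j : coef (inc b * x ^+ i) j = b *+ (i == j).
Proof. by rewrite (spsr_scale H) (spsr_pow H) mulr_natr. Qed.

Lemma spsr_coef_inc b j : coef (inc b) j = b *+ (0%N == j).
Proof. by rewrite -spsr_coef_monomial expr0 mulr1. Qed.

Definition spoly (M : nat) (c : nat -> B) : S := \sum_(i < M) inc (c i) * x ^+ i.

Lemma spsr_coef_poly M c j : coef (spoly M c) j = c j *+ (j < M)%N.
Proof.
rewrite spsr_coef_sum; case: ltnP => hj.
  rewrite (bigD1 (Ordinal hj)) //= spsr_coef_monomial eqxx big1 ?addr0 // => i ne.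
  by rewrite spsr_coef_monomial -[j]/(val (Ordinal hj)) val_eqE (negbTE ne).
rewrite big1 // => i _; rewrite spsr_coef_monomial; case: eqP => // e.
by move: hj; rewrite -e leqNgt ltn_ord.
Qed.

Lemma spsr_coef_trunc M s j : (j < M)%N -> coef (spoly M (coef s)) j = coef s j.
Proof. by rewrite spsr_coef_poly => ->. Qed.

Lemma series_close_eq N s t :
  (forall j, (j < N)%N -> coef s j = coef t j) -> series_close N (coef s) (coef t).
Proof. by move=> h j /h ->; rewrite subrr; exact: (tsi0 (ideal_pow_ideal Hm _)). Qed.

(** Continuity is the only access to products of infinite series: a factor is replaced by a
    truncation, on which the commutation rule and associativity can be used. The bound N <= M keeps
    the coefficients below N of the truncated factor exact. *)
Lemma spsr_mul_approxr s t N : exists2 M, (N <= M)%N & series_close N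
    (coef (s * spoly M (coef t))) (coef (s * t)).
Proof.
have [M hM] := spsr_cont H s t N; exists (maxn N M); first exact: leq_maxl.
by apply: hM; apply: series_close_eq => j // hj; apply: spsr_coef_trunc;
  rewrite leq_max hj orbT.
Qed.

Lemma spsr_mul_approxl s t N : exists2 M, (N <= M)%N & series_close N
    (coef (spoly M (coef s) * t)) (coef (s * t)).
Proof.
have [M hM] := spsr_cont H s t N; exists (maxn N M); first exact: leq_maxl.
by apply: hM; apply: series_close_eq => j // hj; apply: spsr_coef_trunc;
  rewrite leq_max hj orbT.
Qed.

Lemma spsr_coef_eq b c : (forall N, ideal_pow mB N (b - c)) -> b = c.
Proof. by move=> h; apply/eqP; rewrite -subr_eq0; apply/eqP/(proj1 Hc). Qed.

(** The coefficients describe a left module, so right multiplication by [x] needs an argument: it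
    shifts truncations by associativity, and the statement passes to the limit because [B] is
    separated. *)
Lemma spsr_coef_mulX s j : coef (s * x) j = if j is i.+1 then coef s i else 0.
Proof.
apply: spsr_coef_eq => N0; set N := maxn N0 j.+2.
apply: (@ideal_powW _ _ Hm _ N); first exact: leq_maxl.
have [M hM hcl] := spsr_mul_approxl s x N.
have hj : (j < N)%N by rewrite leq_max (leqnSn _) orbT.
have hjM : (j < M)%N by exact: leq_trans hM.
have := hcl j hj; rewrite {1}/spoly mulr_suml.
under eq_bigr => i _ do rewrite -mulrA -exprSr.
rewrite spsr_coef_sum.
suff -> : \sum_(i < M) coef (inc (coef s i) * x ^+ i.+1) j =
    (if j is i.+1 then coef s i else 0) by exact: (tsiBC (ideal_pow_ideal Hm _)).
clear N hM hcl hj; case: j hjM => [|j] hjM.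
  by rewrite big1 // => i _; rewrite spsr_coef_monomial.
have hj' : (j < M)%N by exact: ltnW.
rewrite (bigD1 (Ordinal hj')) //= spsr_coef_monomial eqxx big1 ?addr0 // => i ne.
by rewrite spsr_coef_monomial eqSS -[j]/(val (Ordinal hj')) val_eqE (negbTE ne).
Qed.

Lemma spsr_coef_mulXn s i j :
  coef (s * x ^+ i) j = if (i <= j)%N then coef s (j - i) else 0.
Proof.
elim: i j => [|i IHi] j; first by rewrite expr0 mulr1 subn0.
by rewrite exprSr mulrA spsr_coef_mulX; case: j => // j; rewrite IHi.
Qed.

(** Used for the image of [A]. Such an element commutes with [x] and with coefficients, hence with
    truncations, hence with their limits. *)
Lemma spsr_scalar_central b : sigma b = b -> delta b = 0 ->
  (forall c, b * c = c * b) -> forall s, inc b * s = s * inc b.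
Proof.
move=> sb db hb s; apply: (spsr_inj H) => j.
have xb : x * inc b = inc b * x by rewrite (spsr_comm H) sb db rmorph0 addr0.
have xnb i : x ^+ i * inc b = inc b * x ^+ i.
  by apply/esym; apply: commrX; exact/esym.
apply: spsr_coef_eq => N0; set N := maxn N0 j.+1.
apply: (@ideal_powW _ _ Hm _ N); first exact: leq_maxl.
have [M hM hcl] := spsr_mul_approxl s (inc b) N.
have hj : (j < N)%N by rewrite leq_max leqnn orbT.
have := hcl j hj.
have -> : spoly M (coef s) * inc b = inc b * spoly M (coef s).
  rewrite mulr_suml mulr_sumr; apply: eq_bigr => i _.
  by rewrite -mulrA xnb !mulrA -!rmorphM hb.
rewrite !(spsr_scale H) spsr_coef_trunc //; exact: leq_trans hM.
Qed.

(** Candidate for the N-th power of the maximal ideal of [S], confirmed in [spsr_ideal_pow].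
    Truncated subtraction leaves the coefficients with j >= N free, as x^j then already has degree
    at least N. *)
Definition series_ideal N : set S := [set s | forall j, ideal_pow mB (N - j) (coef s j)].

Lemma series_ideal_closed N s :
  (forall N', exists2 s', series_ideal N s' & series_close N' (coef s') (coef s)) ->
  series_ideal N s.
Proof.
(* Precision N - j gives the congruence that is needed; precision j + 1 ensures that the coefficient
   of index j is compared at all. *)
move=> h j; have [s' hs' hcl] := h (maxn (N - j) j.+1).
have hj : (j < maxn (N - j) j.+1)%N by rewrite leq_max leqnn orbT.
apply: (tsiBl (ideal_pow_ideal Hm _)) (hs' j).
apply: (tsiBC (ideal_pow_ideal Hm _)).
by apply: (ideal_powW Hm) (hcl j hj); exact: leq_maxl.
Qed.

Lemma series_ideal_sum N (K : Type) (r : seq K) (P : pred K) (f : K -> S) :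
  (forall i, P i -> series_ideal N (f i)) ->
  series_ideal N (\sum_(i <- r | P i) f i).
Proof.
move=> h j; rewrite spsr_coef_sum; apply: (tsi_sum (ideal_pow_ideal Hm _)) => i hi.
exact: h.
Qed.

Lemma series_idealW N M s : (N <= M)%N -> series_ideal M s -> series_ideal N s.
Proof. by move=> h hs j; apply: (ideal_powW Hm) (hs j); exact: leq_sub2r. Qed.

Lemma series_ideal_scale l N b s :
  ideal_pow mB l b -> series_ideal N s -> series_ideal (l + N) (inc b * s).
Proof.
move=> hb hs j; rewrite (spsr_scale H).
apply: (@ideal_powW _ _ Hm _ (l + (N - j))); last exact: (ideal_powM Hm).
rewrite leq_subLR; case: (leqP j N) => h; first by rewrite addnCA subnKC.
by rewrite addnCA leq_add2l (leq_trans (ltnW h)) ?leq_addr.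
Qed.

Lemma series_ideal_monomial l b i :
  ideal_pow mB l b -> series_ideal (l + i) (inc b * x ^+ i).
Proof.
move=> hb; apply: series_ideal_scale => // j; rewrite (spsr_pow H).
by case: eqP => [->|_]; rewrite ?subnn //; exact: (tsi0 (ideal_pow_ideal Hm _)).
Qed.

(** This is where locality enters. In x b x^i = sigma(b) x^(i+1) + delta(b) x^i the first term gains
    a degree from [x], the second because [delta] raises the power of the maximal ideal by one. *)
Lemma series_idealMx N s : series_ideal N s -> series_ideal N.+1 (x * s).
Proof.
move=> hs; apply: series_ideal_closed => N'.
have [M hM hcl] := spsr_mul_approxr x s N'; exists (x * spoly M (coef s)) => //.
rewrite /spoly mulr_sumr; apply: series_ideal_sum => i _.
rewrite mulrA (spsr_comm H) mulrDl -mulrA -exprS.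
have [hsig hdel] := Hl (N - i)%N.
have h1 : ideal_pow mB (N - i)%N (sigma (coef s i)).
  by rewrite -hsig; exists (coef s i).
have h2 : ideal_pow mB (N - i)%N.+1 (delta (coef s i)).
  by apply: hdel; exists (coef s i).
have h3 : (N <= N - i + i)%N by rewrite addnC -leq_subLR.
move=> j; rewrite (spsr_add H).
apply: (tsiD (ideal_pow_ideal Hm _)).
  apply: (@series_idealW N.+1 (N - i + i.+1)); first by rewrite addnS ltnS.
  exact: series_ideal_monomial.
apply: (@series_idealW N.+1 ((N - i).+1 + i)); first by rewrite addSn ltnS.
exact: series_ideal_monomial.
Qed.

Lemma series_idealM N M s t :
  series_ideal N s -> series_ideal M t -> series_ideal (N + M) (s * t).
Proof.
move=> hs ht; apply: series_ideal_closed => N'.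
have [K hK hcl] := spsr_mul_approxl s t N'; exists (spoly K (coef s) * t) => //.
rewrite mulr_suml; apply: series_ideal_sum => i _; rewrite -mulrA.
have h : series_ideal (i + M) (x ^+ i * t).
  by elim: (i : nat) => [|j IHj]; rewrite ?mul1r // exprS -mulrA; exact: series_idealMx.
apply: (@series_idealW _ (N - i + (i + M))).
  by rewrite addnA leq_add2r addnC -leq_subLR.
exact: series_ideal_scale.
Qed.

Lemma series_idealB N s t :
  series_ideal N s -> series_ideal N t -> series_ideal N (s - t).
Proof.
by move=> hs ht j; rewrite spsr_coefB; apply: (tsiB (ideal_pow_ideal Hm _)).
Qed.

Lemma series_ideal_ideal N : two_sided_ideal (series_ideal N).
Proof.
split.
- by move=> j; rewrite spsr_coef0; exact: (tsi0 (ideal_pow_ideal Hm _)).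
- exact: series_idealB.
- by move=> a s hs; exact: (@series_idealM 0).
- by move=> a s hs; rewrite -[N]addn0; exact: series_idealM.
Qed.

Lemma series_ideal_separated s : (forall N, series_ideal N s) -> s = 0.
Proof.
move=> h; apply: (spsr_inj H) => j; rewrite spsr_coef0; apply: (proj1 Hc) => i.
by have := h (i + j)%N j; rewrite addnK.
Qed.

Lemma series_ideal_complete (u : nat -> S) :
  (forall i, series_ideal i (u i.+1 - u i)) ->
  exists l, forall i, series_ideal i (l - u i).
Proof.
move=> hu.
have /choice[c hc] : forall j, exists l, forall i,
    ideal_pow mB i (l - coef (u (i + j)%N) j).
  (* The shift of the index by j compensates the loss in the j-th coefficient, where degree i + j
     only gives membership in the i-th power. *)
  move=> j; apply: (proj2 Hc) => i; rewrite -spsr_coefB.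
  by have := hu (i + j)%N j; rewrite addnK.
have [l hl] := spsr_surj H c; exists l => i j; rewrite spsr_coefB hl.
case: (leqP i j) => [|/ltnW hij]; first by rewrite -subn_eq0 => /eqP ->.
by have := hc j (i - j)%N; rewrite subnK.
Qed.

(** The geometric series in [s] converges to the inverse; both one-sided identities are checked
    modulo every [series_ideal N]. *)
Lemma series_ideal_inv s : series_ideal 1 s -> (1 - s) \is a GRing.unit.
Proof.
move=> hs.
have hX i : series_ideal i (s ^+ i).
  by elim: i => [//|i IHi]; rewrite exprS; exact: (@series_idealM 1).
have [i|l hl] := series_ideal_complete (u := fun N => \sum_(i < N) s ^+ i).
  by rewrite /= big_ord_recr /= addrAC subrr add0r; exact: hX.
have e N : (1 - s) * \sum_(i < N) s ^+ i = 1 - s ^+ N.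
  by rewrite -opprB mulNr -subrX1 opprB.
have e' N : (\sum_(i < N) s ^+ i) * (1 - s) = 1 - s ^+ N.
  rewrite -e; apply/esym/commr_sum => i _; apply: commrX; apply: commr_sym.
  by apply: commrB; [exact: commr1|].
apply/unitrP; exists l; split; apply/eqP; rewrite -subr_eq0; apply/eqP;
  apply: series_ideal_separated => N.
- have -> : l * (1 - s) - 1 = (l - \sum_(i < N) s ^+ i) * (1 - s) - s ^+ N.
    by rewrite [in RHS]mulrBl e' opprB -[in RHS]addrA [s ^+ N - 1 - _]addrAC subrr sub0r.
  apply: (tsiB (series_ideal_ideal N)) (hX N).
  exact: (tsiMr (series_ideal_ideal N)).
- have -> : (1 - s) * l - 1 = (1 - s) * (l - \sum_(i < N) s ^+ i) - s ^+ N.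
    by rewrite [in RHS]mulrBr e opprB -[in RHS]addrA [s ^+ N - 1 - _]addrAC subrr sub0r.
  apply: (tsiB (series_ideal_ideal N)) (hX N).
  exact: (tsiMl (series_ideal_ideal N)).
Qed.

Lemma spsr_max_ideal : @max_ideal S = series_ideal 1.
Proof.
apply/seteqP; split=> s; last first.
  move=> hs; apply/negP => /unitrP[t [_ st]].
  have : series_ideal 1 1 by rewrite -st; exact: (tsiMr (series_ideal_ideal 1)).
  move=> /(_ 0%N); rewrite -(expr0 x) (spsr_pow H) eqxx => /(ideal_pow1 Hm).
  by rewrite /mB /max_ideal /= unitr1.
(* If the constant coefficient b is a unit, then b^-1 s differs from 1 by an element without
   constant coefficient, so the geometric series inverts it. *)
move=> hs [|j] //=; apply/(ideal_pow1 Hm); move: hs; rewrite /mB /max_ideal /=.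
apply: contraNN; set b := coef s 0 => hs0.
have hi : inc b^-1 \is a GRing.unit by rewrite rmorph_unit // unitrV.
rewrite -(unitrMr _ hi) -[_ * s](subKr 1); apply: series_ideal_inv => -[|j] //.
apply/(ideal_pow1 Hm); rewrite spsr_coefB (spsr_scale H) mulVr //.
by rewrite -(expr0 x) (spsr_pow H) eqxx subrr; exact: (tsi0 Hm).
Qed.

Lemma spsr_ideal_pow_inc l b : ideal_pow mB l b -> ideal_pow (@max_ideal S) l (inc b).
Proof.
have Hi := ideal_pow_ideal (eq_ind_r _ (series_ideal_ideal 1) spsr_max_ideal).
elim: l b => [//|l IHl] _ [s [hs ->]]; rewrite rmorph_sum.
apply: (tsi_sum_seq (Hi l.+1)) => ab /hs[h1 h2]; rewrite rmorphM.
apply: ideal_powSM; last exact: IHl.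
rewrite spsr_max_ideal => -[|j] //; apply/(ideal_pow1 Hm).
by rewrite spsr_coef_inc eqxx.
Qed.

Lemma spsr_var_max_ideal : @max_ideal S x.
Proof.
rewrite spsr_max_ideal -[x]expr1 => -[|j] //.
by rewrite (spsr_pow H); exact: (tsi0 (ideal_pow_ideal Hm _)).
Qed.

(** Elements of [ideal_pow] are finite sums, so the infinite tail of a series must be handled in one
    stroke: it is t x^N for a single series t. *)
Lemma spsr_ideal_pow N : ideal_pow (@max_ideal S) N = series_ideal N.
Proof.
have HS : two_sided_ideal (@max_ideal S).
  by rewrite spsr_max_ideal; exact: series_ideal_ideal.
have Hi := ideal_pow_ideal HS.
apply/seteqP; split=> s.
  elim: N s => [//|N IHN] _ [l [hl ->]]; rewrite big_seq.
  apply: series_ideal_sum => ab /hl[h1 /IHN h2].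
  by rewrite -add1n; apply: series_idealM => //; rewrite -spsr_max_ideal.
move=> hs; have [t ht] := spsr_surj H (fun j => coef s (j + N)%N).
have -> : s = spoly N (coef s) + t * x ^+ N.
  apply: (spsr_inj H) => j; rewrite (spsr_add H) spsr_coef_poly spsr_coef_mulXn ht.
  by case: ltnP => h; rewrite ?addr0 // subnK // add0r.
apply: (tsiD (Hi N)); last first.
  by apply: (tsiMl (Hi N)); apply: ideal_powX => //; exact: spsr_var_max_ideal.
apply: (tsi_sum (Hi N)) => i _.
apply: (@ideal_powW _ _ HS _ (N - i + i)); first by rewrite subnK // ltnW.
apply: (ideal_powM HS); first by apply: spsr_ideal_pow_inc; exact: hs.
by apply: ideal_powX => //; exact: spsr_var_max_ideal.
Qed.

Lemma spsr_adic_complete : adic_complete (@max_ideal S).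
Proof.
split=> [b hb|u hu].
  by apply: series_ideal_separated => N; rewrite -spsr_ideal_pow.
have [i|l hl] := @series_ideal_complete u; first by rewrite -spsr_ideal_pow.
by exists l => i; rewrite spsr_ideal_pow.
Qed.

End SkewPowerSeries.

(** * Monomial bases of the adic filtration *)

(** The last exponent is split off because [iterated_skew] appends each new variable at the end.
    Plain lists are used since the number of variables changes along that induction. *)
Fixpoint expts (m N : nat) : seq (seq nat) :=
  if m is m'.+1 then
    [seq rcons e j | j <- index_iota 0 N.+1, e <- expts m' (N - j)]
  else if N is 0 then [:: [::]] else [::].

Lemma exptsS m N : expts m.+1 N =
  [seq rcons e j | j <- index_iota 0 N.+1, e <- expts m (N - j)].
Proof. by []. Qed.

Lemma exptsP m N e : reflect (size e = m /\ sumn e = N) (e \in expts m N).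
Proof.
elim: m N e => [|m IHm] N e.
  by case: N => [|N]; rewrite ?inE; apply: (iffP idP) => //;
    [move/eqP-> | case=> /size0nil -> | case=> /size0nil ->].
rewrite exptsS; apply: (iffP allpairsPdep) => [[j [d [hj /IHm[<- hd] ->]]]|].
  by rewrite size_rcons sumn_rcons hd subnK //; move: hj; rewrite mem_index_iota.
case/lastP: e => [|d j]; first by case.
rewrite size_rcons sumn_rcons => -[[hd] hN]; exists j, d; split=> //.
  by rewrite mem_index_iota ltnS -hN leq_addl.
by apply/IHm; rewrite -hN addnK.
Qed.

Lemma expts_uniq m N : uniq (expts m N).
Proof.
elim: m N => [|m IHm] N; first by case: N.
rewrite exptsS; apply: allpairs_uniq_dep => [|j _|]; rewrite ?iota_uniq //.
by move=> [j d] [j' d'] _ _ /= /eqP; rewrite eqseq_rcons => /andP[/eqP -> /eqP ->].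
Qed.

Definition seq_mon (B : pzRingType) (xs : seq B) (e : seq nat) : B :=
  \prod_(ye <- zip xs e) ye.1 ^+ ye.2.

Lemma seq_mon_rcons (B : pzRingType) (xs : seq B) x e j : size xs = size e ->
  seq_mon (rcons xs x) (rcons e j) = seq_mon xs e * x ^+ j.
Proof. by move=> h; rewrite /seq_mon zip_rcons // -cats1 big_cat big_seq1. Qed.

Lemma seq_mon_map (B S : pzRingType) (f : {rmorphism B -> S}) (xs : seq B) e :
  seq_mon (map f xs) e = f (seq_mon xs e).
Proof.
elim: xs e => [|x xs IH] [|j e]; rewrite /seq_mon ?big_nil ?rmorph1 //.
by rewrite !big_cons /= rmorphM rmorphXn; congr (_ * _); exact: IH.
Qed.

Definition homog_sum (k : Type) (A B : pzRingType) (io : k -> A) (a : A -> B)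
    (xs : seq B) (N : nat) (c : seq nat -> k) : B :=
  \sum_(e <- expts (size xs) N) a (io (c e)) * seq_mon xs e.

(* The last two fields say that the monomials of degree N in xs form a k-basis
   of m^N / m^(N+1). *)
Record graded_basis (k : nmodType) (A B : unitRingType) (io : k -> A)
    (a : A -> B) (xs : seq B) : Prop := {
  gb_ideal : two_sided_ideal (@max_ideal B);
  gb_complete : adic_complete (@max_ideal B);
  gb_central : forall u b, a u * b = b * a u;
  gb_local : forall u, max_ideal u -> @max_ideal B (a u);
  gb_var : forall y, y \in xs -> @max_ideal B y;
  gb_span : forall N b, ideal_pow (@max_ideal B) N b ->
    exists c, ideal_pow (@max_ideal B) N.+1 (b - homog_sum io a xs N c);
  gb_free : forall N c, ideal_pow (@max_ideal B) N.+1 (homog_sum io a xs N c) ->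
    forall e, e \in expts (size xs) N -> c e = 0
}.

(** * Adjoining one variable to a graded basis *)

Section Step.
Variables (k : nmodType) (A B S : unitRingType) (io : k -> A).
Variables (a : {rmorphism A -> B}) (xs : seq B) (sigma delta : B -> B).
Variables (inc : {rmorphism B -> S}) (x : S) (coef : S -> nat -> B).
Hypothesis HB : graded_basis io a xs.
Hypothesis H : skew_power_series_ring sigma delta inc x coef.
Hypothesis Hl : local_skew sigma delta.
Hypothesis Hlin : linear_skew a sigma delta.

Let Hm := gb_ideal HB.
Let Hc := gb_complete HB.

(** A form of degree N has as coefficient of x^j a form of degree N - j over [B]; so the basis
    property in degree N splits into those of [B] in the degrees N - j. *)
Lemma homog_sum_step N c :
  homog_sum io (inc \o a) (rcons [seq inc b | b <- xs] x) N c =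
  spoly inc x N.+1 (fun j => homog_sum io a xs (N - j) (fun e => c (rcons e j))).
Proof.
rewrite /homog_sum size_rcons size_map exptsS big_allpairs_dep big_mkord.
apply: eq_bigr => j _; rewrite rmorph_sum mulr_suml.
rewrite big_seq [RHS]big_seq; apply: eq_bigr => e /exptsP[he _].
by rewrite seq_mon_rcons ?size_map // seq_mon_map mulrA rmorphM.
Qed.

Lemma graded_basis_step :
  graded_basis io (inc \o a) (rcons [seq inc b | b <- xs] x).
Proof.
have PN N : ideal_pow (@max_ideal S) N = series_ideal coef N.
  exact: (spsr_ideal_pow H Hm Hc Hl).
have mS : @max_ideal S = series_ideal coef 1 by exact: (spsr_max_ideal H Hm Hc Hl).
have mi b : max_ideal b -> @max_ideal S (inc b).
  rewrite mS => hb [|j] //; apply/(ideal_pow1 Hm).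
  by rewrite (spsr_coef_inc H) eqxx.
split.
- by rewrite mS; exact: (series_ideal_ideal H Hm Hl).
- exact: (spsr_adic_complete H Hm Hc Hl).
- move=> u s /=; have [h1 h2] := Hlin u.
  by apply: (spsr_scalar_central H Hm Hc) => // b; exact: (gb_central HB).
- by move=> u hu; apply: mi; exact: (gb_local HB).
- move=> y; rewrite mem_rcons inE => /orP[/eqP ->|/mapP[b hb ->]].
    exact: (spsr_var_max_ideal H Hm Hc Hl).
  by apply: mi; exact: (gb_var HB).
- move=> N s; rewrite !PN => hs.
  have /choice[c hc] : forall j, exists c, ideal_pow (@max_ideal B) (N - j).+1
    (coef s j - homog_sum io a xs (N - j) c) by move=> j; exact: (gb_span HB).
  (* This undoes [rcons]: the last entry selects the coefficient function found for the j-th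
     coefficient, the rest is its argument. *)
  exists (fun e => c (last 0%N e) (take (size e).-1 e)); rewrite homog_sum_step => j.
  rewrite (spsr_coefB H) (spsr_coef_poly H).
  case: ltnP => hj; last by move: hj; rewrite -subn_eq0 => /eqP ->.
  rewrite subSn // mulr1n.
  rewrite [homog_sum _ _ _ _ _](_ : _ = homog_sum io a xs (N - j) (c j)) //.
  apply: eq_bigr => e _.
  by rewrite last_rcons size_rcons /= -cats1 take_size_cat.
- move=> N c; rewrite PN homog_sum_step => h e.
  rewrite size_rcons size_map exptsS => /allpairsPdep[j [d [hj hd ->]]].
  move: hj; rewrite mem_index_iota /= => hj.
  have := h j; rewrite (spsr_coef_poly H) hj subSn // => h'.
  exact: (gb_free HB h' hd).
Qed.

End Step.

(* If A is a field then x0 is empty, head 0 x0 is 0, and rs_max says that the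
   maximal ideal vanishes; otherwise head 0 x0 is the uniformiser. *)
Record residue_section (k : fieldType) (A : unitRingType) (io : k -> A)
    (x0 : seq A) : Prop := {
  rs0 : io 0 = 0;
  rs1 : io 1 = 1;
  rsM : {morph io : c d / c * d};
  rsD : forall c d, max_ideal (io c + io d - io (c + d));
  rs_red : forall u, exists c, max_ideal (u - io c);
  rs_max : forall u, max_ideal u -> exists v, u = head 0 x0 * v;
  rs_size : (size x0 <= 1)%N
}.

(** * The two kinds of coefficient ring *)

Lemma graded_basis_field (k : fieldType) : @graded_basis k k k id idfun [::].
Proof.
have m0 (b : k) : max_ideal b <-> b = 0.
  by rewrite /max_ideal /= unitfE negbK; split=> [/eqP|->].
have mS i (b : k) : ideal_pow (@max_ideal k) i.+1 b <-> b = 0.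
  split=> [[l [hl ->]]|->].
    rewrite big_seq big1 // => ab /hl[/m0 -> _]; exact: mul0r.
  by exists [::]; rewrite big_nil.
have Hm : two_sided_ideal (@max_ideal k).
  split=> [|x y /m0 -> /m0 ->|x y /m0 ->|x y /m0 ->];
    by apply/m0; rewrite ?subrr ?mulr0 ?mul0r.
split=> //=.
- split=> [b h|u hu]; first exact/(mS 0%N)/(h 1%N).
  (* Positive powers of the maximal ideal are zero, so the sequence is constant from index 1 on; its
     step from index 0 is unconstrained. *)
  exists (u 1%N) => -[|i] //; apply/(mS i).
  elim: i => [|i IHi]; first by rewrite subrr.
  by rewrite -(subrK (u i.+1) (u i.+2)) opprD addrCA IHi addr0 ((mS _ _).1 (hu _)) oppr0.
- by move=> u b; rewrite mulrC.
- move=> [|N] b hb; rewrite /homog_sum /=.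
    exists (fun _ => b); apply/(mS 0%N).
    by rewrite big_seq1 /seq_mon big_nil mulr1 subrr.
  by exists (fun _ => 0); rewrite big_nil subr0; apply/(mS N.+1)/(mS N).
- move=> [|N] c //; rewrite /homog_sum /= big_seq1 /seq_mon big_nil mulr1.
  by move=> /(mS 0%N) h e; rewrite inE => /eqP ->.
Qed.

Lemma homog_sum1 (k : Type) (A : pzRingType) (io : k -> A) (t : A) N c :
  homog_sum io idfun [:: t] N c = io (c [:: N]) * t ^+ N.
Proof.
rewrite /homog_sum [size _]/= exptsS big_allpairs_dep big_mkord big_ord_recr /= subnn big1 ?add0r.
  by rewrite big_seq1 /seq_mon /= big_seq1.
move=> j _; case: (N - j)%N (subn_gt0 j N); last by move=> n; rewrite big_nil.
by rewrite ltn_ord.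
Qed.

Lemma coefficient_ring_basis p (k : finFieldType) (A : unitRingType) (io : k -> A) x0 :
  coefficient_ring p io x0 -> residue_section io x0 /\ graded_basis io idfun x0.
Proof.
case=> {A io x0} [hp|A red io t hp [_ mD [d [d0 dm]]] hc _ rsur rker ht ioK ioM].
  split; last exact: graded_basis_field.
  have m0 : max_ideal (0 : k) by rewrite /max_ideal /= unitr0.
  split=> //= [c d|u|u]; first by rewrite subrr.
    by exists u; rewrite subrr.
  by rewrite /max_ideal /= unitfE negbK => /eqP ->; exists 0; rewrite mulr0.
have mt u : max_ideal u <-> exists v, u = v * t.
  by move: ht; rewrite /uniformiser => ->; split=> [[v _ <-]|[v ->]]; exists v.
have t0 : t != 0.
  by apply: contraNneq d0 => t0; have /mt[v ->] := dm; rewrite t0 mulr0.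
have Hm : two_sided_ideal (@max_ideal A).
  have hl x y : max_ideal y -> @max_ideal A (x * y).
    by move=> /mt[v ->]; apply/mt; exists (x * v); rewrite mulrA.
  split=> //; first by apply/mt; exists 0; rewrite mul0r.
    by move=> x y hx hy; apply: mD => //; rewrite -mulN1r; exact: hl.
  by move=> x y hy; rewrite mulrC; exact: hl.
have mX i b : ideal_pow (@max_ideal A) i b <-> exists v, b = v * t ^+ i.
  elim: i b => [|i IHi] b; first by split=> // _; exists b; rewrite mulr1.
  split=> [[l [hl ->]]|[v ->]]; last first.
    rewrite exprSr mulrA mulrC; apply: (ideal_powSM _ _).
      by apply/mt; exists 1; rewrite mul1r.
    by apply/IHi; exists v.
  rewrite big_seq; elim/big_ind: _ => [|x y [v ->] [w ->]|ab /hl[/mt[v ->] /IHi[w ->]]].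
  - by exists 0; rewrite mul0r.
  - by exists (v + w); rewrite mulrDl.
  - by exists (v * w); rewrite exprS mulrACA.
have mio c : max_ideal (io c) -> c = 0 by move=> /rker; rewrite ioK.
split; split=> //.
(* By multiplicativity [io 0] and [io 1] are idempotents of a domain, hence 0 or 1, and [red]
   excludes the wrong value. *)
- have /eqP : io 0 * (io 0 - 1) = 0 by rewrite mulrBr mulr1 -ioM mulr0 subrr.
  rewrite mulf_eq0 => /orP[/eqP//|]; rewrite subr_eq0 => /eqP e.
  by have := ioK 0; rewrite e rmorph1 => /eqP; rewrite oner_eq0.
- have /eqP : io 1 * (io 1 - 1) = 0 by rewrite mulrBr mulr1 -ioM mulr1 subrr.
  rewrite mulf_eq0 subr_eq0 => /orP[/eqP e|/eqP//].
  by have := ioK 1; rewrite e rmorph0 => /esym/eqP; rewrite oner_eq0.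
- by move=> c e; apply/rker; rewrite rmorphB rmorphD !ioK subrr.
- by move=> u; exists (red u); apply/rker; rewrite rmorphB ioK subrr.
- by move=> u /mt[v ->]; exists v; rewrite mulrC.
- by move=> u b /=; rewrite mulrC.
- by move=> y; rewrite inE => /eqP ->; apply/mt; exists 1; rewrite mul1r.
- move=> N b /mX[v ->]; exists (fun _ => red v); rewrite homog_sum1 -mulrBl.
  have /rker/mt[w ->] : red (v - io (red v)) = 0 by rewrite rmorphB ioK subrr.
  by apply/mX; exists w; rewrite exprS mulrA.
- move=> N c; rewrite homog_sum1 => /mX[v].
  rewrite exprSr mulrA [v * _]mulrC -mulrA [RHS]mulrC => /(mulIf (expf_neq0 N t0)) ec e.
  have /mio cN : max_ideal (io (c [:: N])) by apply/mt; exists v.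
  move=> /exptsP[].
  by case: e => [|j [|l e]] //= _; rewrite addn0 => ->.
Qed.

(** The second conclusion keeps track of the fact that the uniformiser, if there is one, stays the
    first variable; carries rely on it. *)
Lemma iterated_skew_basis (k : fieldType) (A : unitRingType) (io : k -> A) x0
    (R : unitRingType) (a : {rmorphism A -> R}) subs xs :
  graded_basis io idfun x0 -> iterated_skew x0 a subs xs ->
  graded_basis io a xs /\ exists ys, xs = [seq a t | t <- x0] ++ ys.
Proof.
move=> H0 hR; elim: hR H0 => {R a subs xs} [|B S a subs xs sigma delta inc x coef _ IH
  _ hloc hlin _ H] H0.
  by split=> //; exists [::]; rewrite cats0 map_id_in.
have [hB [ys e]] := IH H0; split; first by apply: (graded_basis_step hB H hloc hlin).
exists (rcons [seq inc b | b <- ys] x).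
by rewrite e map_cat -map_comp -rcons_cat.
Qed.

(** * Expansions *)

Section Monomials.
Variable n : nat.
Implicit Types (al be : 'X_{1..n}) (e : seq nat).

Definition mnm_of_seq e : 'X_{1..n} := [multinom nth 0%N e i | i < n].

Lemma mnm_of_seqK al : mnm_of_seq al = al.
Proof. by apply/mnmP => i; rewrite mnmE (mnm_nth 0%N). Qed.

Lemma seq_of_mnmK e : size e = n -> mnm_of_seq e = e :> seq nat.
Proof.
move=> he; apply: (@eq_from_nth _ 0%N); first by rewrite size_tuple.
move=> i; rewrite size_tuple => hi.
by rewrite -[i]/(nat_of_ord (Ordinal hi)) -mnm_nth mnmE.
Qed.

Definition mnms_eq (N : nat) : seq 'X_{1..n} := [seq mnm_of_seq e | e <- expts n N].

Lemma mem_mnms_eq N al : (al \in mnms_eq N) = (mdeg al == N).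
Proof.
apply/mapP/eqP => [[e /exptsP[he hN] ->]|hN].
  by rewrite -hN /mdeg (seq_of_mnmK he) sumnE.
exists (al : seq nat); last by rewrite mnm_of_seqK.
by apply/exptsP; rewrite size_tuple sumnE.
Qed.

Lemma mnms_eq_uniq N : uniq (mnms_eq N).
Proof.
rewrite map_inj_in_uniq ?expts_uniq // => e e' /exptsP[he _] /exptsP[he' _] h.
by rewrite -(seq_of_mnmK he) h seq_of_mnmK.
Qed.

Fixpoint mnms_lt (N : nat) : seq 'X_{1..n} :=
  if N is N'.+1 then mnms_lt N' ++ mnms_eq N' else [::].

Lemma mem_mnms_lt N al : (al \in mnms_lt N) = (mdeg al < N)%N.
Proof.
elim: N => [//|N IHN]; rewrite /= mem_cat IHN mem_mnms_eq.
by rewrite [in RHS]ltnS [in RHS]leq_eqVlt orbC.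
Qed.

Lemma mnms_lt_uniq N : uniq (mnms_lt N).
Proof.
elim: N => [//|N IHN] /=; rewrite cat_uniq IHN mnms_eq_uniq andbT /=.
apply/hasPn => al; rewrite mem_mnms_eq mem_mnms_lt => /eqP ->.
by rewrite ltnn.
Qed.

Lemma mon_seq (R : pzRingType) (x : n.-tuple R) al : mon x al = seq_mon x al.
Proof.
rewrite /seq_mon (big_nth (0, 0%N)) size_zip !size_tuple minnn big_mkord.
apply: eq_bigr => i _; rewrite nth_zip ?size_tuple //=.
by rewrite (tnth_nth 0) (mnm_nth 0%N).
Qed.

Lemma mon0 (R : pzRingType) (x : n.-tuple R) : mon x 0%MM = 1.
Proof. by rewrite /mon big1 // => i _; rewrite mnm0E expr0. Qed.

End Monomials.

Section Digits.
Variables (k : finFieldType) (A R : unitRingType) (io : k -> A) (x0 : seq A).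
Variables (a : {rmorphism A -> R}) (n : nat) (x : n.-tuple R).
Hypothesis HS : residue_section io x0.
Hypothesis HB : graded_basis io a x.
Implicit Types (al be : 'X_{1..n}) (c d : 'X_{1..n} -> k) (r s : R).

Local Notation F := (ideal_pow (@max_ideal R)).
Let Hm := gb_ideal HB.
Let HF := ideal_pow_ideal Hm.
Let HFD N := tsiD (HF N).
Local Notation g c := (a (io c)).

Definition psum c N : R := \sum_(al <- mnms_lt n N) g (c al) * mon x al.

(** Convergence along truncations by degree is better suited to induction than the unordered
    summation in [expansion]; [digits_coefs] relates the two. *)
Definition digits c r : Prop := forall N, F N (r - psum c N).

Lemma mon_ideal_pow al : F (mdeg al) (mon x al).
Proof.
rewrite mdegE /mon; elim: (index_enum _) => [|i l IHl]; first by rewrite !big_nil.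
rewrite !big_cons; apply: (ideal_powM Hm) => //.
by apply: ideal_powX; apply: (gb_var HB); exact: mem_tnth.
Qed.

Lemma term_ideal_pow N u al : (N <= mdeg al)%N -> F N (a u * mon x al).
Proof.
move=> h; apply: (tsiMl (HF N)); apply: (ideal_powW Hm) (mon_ideal_pow al).
exact: h.
Qed.

Lemma digit_span N r : F N r ->
  exists c, F N.+1 (r - \sum_(al <- mnms_eq n N) g (c al) * mon x al).
Proof.
move=> /(gb_span HB)[c hc]; exists (fun al => c al).
move: hc; rewrite /homog_sum size_tuple big_map; congr (F _ (r - _)).
rewrite big_seq [RHS]big_seq; apply: eq_bigr => e /exptsP[he _].
by rewrite mon_seq !seq_of_mnmK.
Qed.

Lemma digit_free N c : F N.+1 (\sum_(al <- mnms_eq n N) g (c al) * mon x al) ->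
  forall al, mdeg al = N -> c al = 0.
Proof.
move=> h al hal; rewrite -(mnm_of_seqK al).
apply: (gb_free HB (N := N) (c := fun e => c (mnm_of_seq n e))); last first.
  by apply/exptsP; rewrite !size_tuple sumnE.
move: h; rewrite /homog_sum size_tuple big_map; congr (F _ _).
rewrite big_seq [RHS]big_seq; apply: eq_bigr => e /exptsP[he _].
by rewrite mon_seq !seq_of_mnmK.
Qed.

Lemma psumS c N :
  psum c N.+1 = psum c N + \sum_(al <- mnms_eq n N) g (c al) * mon x al.
Proof. by rewrite /psum /= big_cat. Qed.

Lemma eq_psum c d N :
  (forall al, (mdeg al < N)%N -> c al = d al) -> psum c N = psum d N.
Proof.
move=> h; rewrite /psum big_seq [RHS]big_seq; apply: eq_bigr => al.
by rewrite mem_mnms_lt => /h ->.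
Qed.

Lemma psum_tail c M N : (M <= N)%N -> F M (psum c N - psum c M).
Proof.
move=> /subnKC <-; elim: (N - M)%N => [|i IHi].
  by rewrite addn0 subrr; exact: (tsi0 (HF M)).
rewrite addnS psumS addrAC; apply: HFD => //.
apply: (tsi_sum_seq (HF M)) => al; rewrite mem_mnms_eq => /eqP hal.
by apply: term_ideal_pow; rewrite hal leq_addr.
Qed.

Lemma psum_inj c d N : F N (psum c N - psum d N) ->
  forall al, (mdeg al < N)%N -> c al = d al.
Proof.
elim: N => [//|N IHN] h.
have hlt : forall al, (mdeg al < N)%N -> c al = d al.
  apply: IHN; apply: (tsi_trans (HF N) (c := psum c N.+1)).
    by apply: (tsiBC (HF N)); exact: psum_tail.
  apply: (tsi_trans (HF N)) (psum_tail d (leqnSn N)).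
  by apply: (ideal_powW Hm) h.
move=> al; rewrite ltnS leq_eqVlt => /orP[/eqP hal|/hlt//].
apply/eqP; rewrite -subr_eq0; apply/eqP.
(* The section of c - d differs from the difference of the sections by an element of the maximal
   ideal of [A]. Multiplied by a monomial of degree N, this error falls into m^(N+1) and is
   harmless. *)
move: al hal; apply: (@digit_free N (fun al => c al - d al)).
move: h; rewrite !psumS (eq_psum hlt) opprD addrACA subrr add0r -sumrB.
set u := \sum_(_ <- _) _; set v := \sum_(_ <- _) _ => hu.
suff h : F N.+1 (v - u) by exact: (tsiBl (HF _)) h hu.
rewrite -sumrB; apply: (tsi_sum_seq (HF _)) => al; rewrite mem_mnms_eq => /eqP hal.
rewrite -!mulrBl -[N.+1]add1n; apply: (ideal_powM Hm);
  last by rewrite -hal; exact: mon_ideal_pow.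
apply/(ideal_pow1 Hm); rewrite opprB addrA -rmorphD -rmorphB; apply: (gb_local HB).
by have := rsD HS (c al - d al) (d al); rewrite subrK.
Qed.

Lemma digits_psum c r N d : digits c r -> F N (r - psum d N) ->
  forall al, (mdeg al < N)%N -> c al = d al.
Proof.
move=> hc hd; apply: psum_inj; apply: (tsi_trans (HF N)) hd.
exact: (tsiBC (HF N)).
Qed.

Lemma digits_exist r : exists c, digits c r.
Proof.
have /choice[cN hcN] : forall N, exists c, F N (r - psum c N).
  elim=> [|N [c hc]]; first by exists (fun _ => 0).
  have [d hd] := digit_span hc.
  exists (fun al => if (mdeg al < N)%N then c al else d al).
  rewrite psumS opprD addrA (@eq_psum _ c) => [|al ->//].
  rewrite (eq_big_seq (fun al => g (d al) * mon x al)) // => al.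
  by rewrite mem_mnms_eq => /eqP ->; rewrite ltnn.
(* Diagonal choice: by [psum_inj] the digits of degree below N are the same for all approximations
   of precision at least N. *)
exists (fun al => cN (mdeg al).+1 al) => N.
rewrite (@eq_psum _ (cN N)) // => al hal.
apply: (@psum_inj _ _ (mdeg al).+1) => //.
apply: (tsi_trans (HF _) (c := r)); first exact: (tsiBC (HF _)).
apply: (tsi_trans (HF _)) (psum_tail _ hal).
by apply: (ideal_powW Hm) (hcN N).
Qed.

Lemma digits_inj c d r : digits c r -> digits d r -> c = d.
Proof. by move=> hc hd; apply/funext => al; exact: (digits_psum hc (hd (mdeg al).+1)). Qed.

Lemma big_seq_low_part (s : seq 'X_{1..n}) c N : uniq s -> {subset mnms_lt n N <= s} ->
  F N (\sum_(al <- s) g (c al) * mon x al - psum c N).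
Proof.
move=> us hs; rewrite (bigID (fun al => (mdeg al < N)%N)) /=.
rewrite -big_filter (perm_big (mnms_lt n N)) /=; last first.
  apply: uniq_perm; rewrite ?filter_uniq ?mnms_lt_uniq // => al.
  rewrite mem_filter -mem_mnms_lt.
  by apply/andP/idP => [[]//|h]; split=> //; exact: hs.
rewrite addrAC subrr add0r; apply: (tsi_sum (HF N)) => al; rewrite -leqNgt.
exact: term_ideal_pow.
Qed.

(** The digits form an expansion, so [xget] returns one; uniqueness of digits then forces it to be
    this one. *)
Lemma digits_coefs c r : digits c r -> coefs io a x r = io \o c.
Proof.
move=> hc; have hE : [set c' | expansion io a x r c']%classic (io \o c).
  split=> [al|N]; first by exists (c al).
  exists (mnms_lt n N) => s us hs; apply: (tsi_trans (HF N)) (hc N) _.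
  by apply: (tsiBC (HF N)); exact: big_seq_low_part.
rewrite /coefs; case: xgetP => [c' _ [hr hs]|/(_ _ hE)//].
have /choice[d hd] : forall al, exists u, io u = c' al.
  by move=> al; have [u _ <-] := hr al; exists u.
have {hd} e : c' = io \o d by apply/funext => al; rewrite /= hd.
rewrite {c' hr}e in hs *; congr (io \o _); apply: digits_inj hc => N.
(* Enlarging [s0] by all exponents of degree below N makes the unordered sum agree with the
   truncation modulo m^N. *)
have [s0 hs0] := hs N; pose s := undup (s0 ++ mnms_lt n N).
have us : uniq s by exact: undup_uniq.
apply: (tsi_trans (HF N) (hs0 s us _)).
  by move=> al h; rewrite mem_undup mem_cat h.
apply: big_seq_low_part => // al h; by rewrite mem_undup mem_cat h orbT.
Qed.

Lemma io_eq0 (u : k) : (io u == 0) = (u == 0).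
Proof.
apply/eqP/eqP => [h|->]; last exact: (rs0 HS).
apply/eqP; apply/negPn/negP => u0; have := oner_neq0 A.
by rewrite -(rs1 HS) -(divff u0) (rsM HS) h mul0r eqxx.
Qed.

Lemma digits_supp c r al : digits c r -> supp io a x r al <-> c al != 0.
Proof. by move=> /digits_coefs h; rewrite /supp h /= io_eq0. Qed.

Lemma g0 : g 0 = 0.
Proof. by rewrite (rs0 HS) rmorph0. Qed.

Lemma g1 : g 1 = 1.
Proof. by rewrite (rs1 HS) rmorph1. Qed.

Lemma digits_zero : digits (fun _ => 0) 0.
Proof.
move=> N; rewrite /psum big1 ?subrr => [|al _]; first exact: (tsi0 (HF N)).
by rewrite g0 mul0r.
Qed.

Lemma digits_eq0 c r : digits c r -> (forall al, c al = 0) -> r = 0.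
Proof.
move=> hc c0; apply: (proj1 (gb_complete HB)) => N.
have := hc N; rewrite (@eq_psum _ (fun _ => 0)) // => h.
by apply: (tsiBl (HF N)) h _; rewrite -[psum _ _]subr0; exact: (tsiBC (HF N) (digits_zero N)).
Qed.

Lemma digits_term u al : digits (fun be => if be == al then u else 0) (g u * mon x al).
Proof.
move=> N; rewrite /psum; case: (ltnP (mdeg al) N) => h.
  rewrite (bigD1_seq al) ?mnms_lt_uniq ?mem_mnms_lt //= eqxx big1 ?addr0 ?subrr.
    exact: (tsi0 (HF N)).
  by move=> be /negbTE ->; rewrite g0 mul0r.
rewrite big_seq big1 ?subr0; first exact: term_ideal_pow.
move=> be; rewrite mem_mnms_lt; case: eqP => [->|_ _]; first by rewrite ltnNge h.
by rewrite g0 mul0r.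
Qed.

End Digits.

Lemma mon_first (R : pzRingType) n (x : n.-tuple R) (i : 'I_n) (al : 'X_{1..n}) :
  nat_of_ord i = 0%N -> mon x (al + U_(i))%MM = tnth x i * mon x al.
Proof.
case: n x i al => [x [[]]//|n x i al] hi.
have {hi} -> : i = ord0 by apply: val_inj.
rewrite /mon !big_ord_recl mnmDE mnm1E eqxx addn1 exprS mulrA; congr (_ * _).
by apply: eq_bigr => j _; rewrite mnmDE mnm1E addn0.
Qed.

(** * Closed spans of monomials and the removal of carries *)

Section ClosedSpan.
Variables (k : finFieldType) (A R : unitRingType) (io : k -> A) (x0 : seq A).
Variables (a : {rmorphism A -> R}) (n : nat) (x : n.-tuple R).
Hypothesis HS : residue_section io x0.
Hypothesis HB : graded_basis io a x.
Hypothesis Hx : exists ys, x = [seq a t | t <- x0] ++ ys :> seq R.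
Implicit Types (al be : 'X_{1..n}) (c d : 'X_{1..n} -> k) (r s : R).
Implicit Types (U V W : set 'X_{1..n}) (l : seq (A * 'X_{1..n})).

Local Notation F := (ideal_pow (@max_ideal R)).
Let Hm := gb_ideal HB.
Let HF := ideal_pow_ideal Hm.
Local Notation partial c N := (psum io a x c N).
Local Notation digits c r := (digits io a x c r).

Definition lcomb l : R := \sum_(ue <- l) a ue.1 * mon x ue.2.

(* The coefficients range over A and not over io(k), which need not be additive. *)
Definition closed_span U : set R := fun r =>
  forall N, exists2 l, (forall ue, ue \in l -> U ue.2) & F N (r - lcomb l).

Lemma lcomb_cat l l' : lcomb (l ++ l') = lcomb l + lcomb l'.
Proof. exact: big_cat. Qed.

Lemma closed_span_sub U r s :
  closed_span U r -> closed_span U s -> closed_span U (r - s).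
Proof.
move=> hr hs N; have [l hl el] := hr N; have [l' hl' el'] := hs N.
exists (l ++ [seq (- ue.1, ue.2) | ue <- l']).
  by move=> ue; rewrite mem_cat => /orP[/hl//|/mapP[ue' /hl' h ->]].
rewrite lcomb_cat {2}/lcomb big_map.
under eq_bigr => ue _ do rewrite rmorphN mulNr.
by rewrite sumrN opprD addrACA -opprD; exact: (tsiB (HF N)).
Qed.

Lemma closed_span0 U : closed_span U 0.
Proof.
by move=> N; exists [::] => //; rewrite /lcomb big_nil subrr; exact: (tsi0 (HF N)).
Qed.

Lemma closed_span_add U r s :
  closed_span U r -> closed_span U s -> closed_span U (r + s).
Proof.
move=> hr hs; rewrite -[s]opprK; apply: closed_span_sub => //.
by rewrite -sub0r; apply: closed_span_sub => //; exact: closed_span0.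
Qed.

Lemma closed_span_scale U u r : closed_span U r -> closed_span U (a u * r).
Proof.
move=> hr N; have [l hl el] := hr N; exists [seq (u * ue.1, ue.2) | ue <- l].
  by move=> ue /mapP[ue' /hl h ->].
rewrite (_ : lcomb _ = a u * lcomb l) -?mulrBr; first exact: (tsiMl (HF N)).
by rewrite /lcomb big_map mulr_sumr; apply: eq_bigr => ue _; rewrite rmorphM mulrA.
Qed.

Lemma closed_span_sum U (K : eqType) (l : seq K) (f : K -> R) :
  (forall i, i \in l -> closed_span U (f i)) -> closed_span U (\sum_(i <- l) f i).
Proof.
move=> h; rewrite big_seq; apply: big_ind => //; first exact: closed_span0.
exact: closed_span_add.
Qed.

Lemma closed_span_closed U r :
  (forall N, exists2 s, closed_span U s & F N (r - s)) -> closed_span U r.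
Proof.
move=> h N; have [s hs hrs] := h N; have [l hl el] := hs N.
by exists l => //; exact: (tsi_trans (HF N)) el.
Qed.

(** Multiplicativity is thereby reduced to monomials: coefficients from [A] are central, and the
    powers of m are two-sided, so approximations of both factors give one of the product. *)
Lemma closed_spanM U V W r s :
  (forall al be, U al -> V be -> closed_span W (mon x al * mon x be)) ->
  closed_span U r -> closed_span V s -> closed_span W (r * s).
Proof.
move=> hUV hr hs; apply: closed_span_closed => N.
have [l hl el] := hr N; have [l' hl' el'] := hs N; exists (lcomb l * lcomb l').
  rewrite /lcomb mulr_suml; apply: closed_span_sum => -[u al] /hl /= hal.
  rewrite mulr_sumr; apply: closed_span_sum => -[v be] /hl' /= hbe.
  rewrite -mulrA (mulrA (mon x al)) -(gb_central HB v) -mulrA.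
  by do 2 apply: closed_span_scale; exact: hUV.
apply: (tsi_trans (HF N) (c := r * lcomb l')).
  by rewrite -mulrBr; exact: (tsiMl (HF N)).
by rewrite -mulrBl; exact: (tsiMr (HF N)).
Qed.

Lemma digits_closed_span U c r :
  digits c r -> (forall al, c al != 0 -> U al) -> closed_span U r.
Proof.
move=> hc hU N; exists [seq (io (c al), al) | al <- [seq al <- mnms_lt n N | c al != 0]].
  by move=> ue /mapP[al]; rewrite mem_filter => /andP[/hU h _] ->.
rewrite /lcomb big_map big_filter /=.
rewrite [X in r - X](_ : _ = partial c N); first exact: hc.
rewrite /psum [RHS](bigID (fun al => c al != 0)) /= [X in _ + X]big1 ?addr0 // => al.
by rewrite negbK => /eqP ->; rewrite (g0 a HS) mul0r.
Qed.

(* A uniformiser of A is the first variable, hence can be moved into the monomial. *)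
Lemma carry u al : max_ideal u -> a u * mon x al = 0 \/
  exists i v, a u * mon x al = a v * mon x (al + U_(i))%MM.
Proof.
have [ys ex] := Hx; move=> /(rs_max HS)[v ->]; move: (rs_size HS) ex.
case: x0 => [|t [|//]] _ /= ex; first by left; rewrite mul0r rmorph0 mul0r.
right; have hn : (0 < n)%N by rewrite -(size_tuple x) ex.
exists (Ordinal hn), v; rewrite mon_first // (tnth_nth 0) ex /=.
by rewrite rmorphM (gb_central HB) mulrA.
Qed.

Variable U : set 'X_{1..n}.
Hypothesis U_up : forall al i, U al -> U (al + U_(i))%MM.

(** One round of normalisation: each coefficient in degree N is replaced by a digit, and the
    difference is carried to degree N + 1 without leaving [U]. *)
Lemma normalize_degree N l :
  (forall ue, ue \in l -> U ue.2 /\ (N <= mdeg ue.2)%N) ->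
  exists c l', [/\ forall al, c al != 0 -> U al,
    forall ue, ue \in l' -> U ue.2 /\ (N < mdeg ue.2)%N
  & lcomb l = \sum_(al <- mnms_eq n N) a (io (c al)) * mon x al + lcomb l'].
Proof.
elim: l => [|[u al] l IHl] hl.
  exists (fun _ => 0), [::]; split=> [al|ue|//]; rewrite ?eqxx //.
  by rewrite /lcomb big_nil big1 ?addr0 // => al _; rewrite (g0 a HS) mul0r.
have [|c [l' [hc hl' e]]] := IHl.
  by move=> ue h; apply: hl; rewrite inE h orbT.
have [/= Ual] := hl (u, al) (mem_head _ _).
have lcons v be l2 : lcomb ((v, be) :: l2) = a v * mon x be + lcomb l2.
  by rewrite /lcomb big_cons.
rewrite leq_eqVlt => /orP[/eqP hal|hal]; last first.
  exists c, ((u, al) :: l'); split=> // [ue|]; last by rewrite !lcons e addrCA.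
  by rewrite inE => /orP[/eqP -> //|/hl'].
(* The exponent al may occur again in the list and have received a digit already, so the new digit
   must represent the total. *)
have [c1 hc1] := rs_red HS (u + io (c al)).
pose c' be := if be == al then c1 else c be.
have hc' be : c' be != 0 -> U be.
  by rewrite /c'; case: (be =P al) => [-> _ //|_]; exact: hc.
have e' : lcomb ((u, al) :: l) = \sum_(be <- mnms_eq n N) a (io (c' be)) * mon x be
    + (a (u + io (c al) - io c1) * mon x al + lcomb l').
  have hin : al \in mnms_eq n N by rewrite mem_mnms_eq hal.
  rewrite lcons e !(bigD1_seq al hin (mnms_eq_uniq n N)) /= /c' eqxx.
  rewrite [in RHS](eq_bigr (fun be => a (io (c be)) * mon x be)); last first.
    by move=> be /negbTE ->.
  rewrite rmorphB rmorphD !mulrBl !mulrDl.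
  set p := a u * _; set q := _ * mon x al; set w := \sum_(_ <- _ | _) _.
  set z := a (io c1) * _; rewrite !addrA; congr (_ + _).
  by rewrite [RHS]addrC -![in RHS]addrA addKr [RHS]addrC.
have [h0|[i [v hv]]] := carry al hc1.
  by exists c', l'; split=> //; rewrite e' h0 add0r.
exists c', ((v, al + U_(i))%MM :: l'); split=> // [ue|]; last by rewrite e' hv lcons.
rewrite inE => /orP[/eqP -> /=|/hl'//].
by rewrite mdegD mdeg1 addn1 hal; split=> //; exact: U_up.
Qed.

Lemma normalize l N : (forall ue, ue \in l -> U ue.2) ->
  exists2 c, (forall al, c al != 0 -> U al) & F N (lcomb l - partial c N).
Proof.
move=> hl; suff [c [l' [hc hl' ->]]] : exists c l', [/\ forall al, c al != 0 -> U al,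
    forall ue, ue \in l' -> U ue.2 /\ (N <= mdeg ue.2)%N
  & lcomb l = partial c N + lcomb l'].
  exists c => //; rewrite addrAC subrr add0r.
  apply: (tsi_sum_seq (HF N)) => ue /hl'[_].
  exact: (term_ideal_pow HB).
elim: N => [|N [c [l' [hc hl' e]]]].
  exists (fun _ => 0), l; split=> // [al|ue /hl//|]; first by rewrite eqxx.
  by rewrite /psum big_nil add0r.
have [d [l2 [hd hl2 e2]]] := normalize_degree hl'.
exists (fun al => if (mdeg al < N)%N then c al else d al), l2; split=> //.
  by move=> al; case: ifP => _; [exact: hc|exact: hd].
rewrite e e2 psumS addrA; congr (_ + _ + _).
  by apply: eq_psum => al ->.
by apply: eq_big_seq => al; rewrite mem_mnms_eq => /eqP ->; rewrite ltnn.
Qed.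

Lemma closed_span_digits c r : digits c r -> closed_span U r ->
  forall al, c al != 0 -> U al.
Proof.
move=> hc hr al; have [l hl el] := hr (mdeg al).+1.
have [d hd ed] := normalize (mdeg al).+1 hl.
have -> : c al = d al; last exact: hd.
by apply: (digits_psum HS HB hc (N := (mdeg al).+1)) => //; exact: (tsi_trans (HF _)) ed.
Qed.

End ClosedSpan.

(** * Leading monomials *)

(** Dickson's lemma: every set of exponents lies above finitely many of its members. *)
Lemma dickson n (S : set 'X_{1..n}) : exists2 L : seq 'X_{1..n},
  (forall al, al \in L -> S al) &
  forall be, S be -> exists2 al, al \in L & (al <= be)%MM.
Proof.
(* Induction on the number of coordinates that may still vary on [S]; those outside [D] are
   constant. *)
suff h m (D : {set 'I_n}) : (#|D| < m)%N -> forall S : set 'X_{1..n},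
    (forall al be i, S al -> S be -> i \notin D -> al i = be i) ->
    exists2 L : seq 'X_{1..n}, (forall al, al \in L -> S al) &
      forall be, S be -> exists2 al, al \in L & (al <= be)%MM.
  by apply: (h _ [set: 'I_n]) => [|al be i _ _]; [exact: ltnSn|rewrite inE].
elim: m D => [//|m IHm] D hD {}S hS.
have [[al0 Sal0]|S0] := pselect (exists al, S al); last first.
  by exists [::] => // be Sbe; case: S0; exists be.
(* An element not above [al0] has some coordinate i with a value v < al0 i. So it lies in one of
   finitely many slices, and on each slice one more coordinate is constant. *)
have /choice[L hL] : forall iv : 'I_n * nat, exists L : seq 'X_{1..n},
    iv.1 \in D -> (forall al, al \in L -> S al) /\
      forall be, S be -> be iv.1 = iv.2 -> exists2 al, al \in L & (al <= be)%MM.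
  move=> [i v]; case: (boolP (i \in D)) => iD; last by exists [::].
  have [||L L1 L2] := IHm (D :\ i) _ (fun be => S be /\ be i = v).
  - by move: hD; rewrite (cardsD1 i) iD ltnS.
  - move=> al be j [h1 e1] [h2 e2]; rewrite in_setD1 negb_and negbK.
    by case/orP=> [/eqP ->|]; [rewrite e1 e2|exact: hS].
  - by exists L => _; split=> [al /L1[]//|be h1 h2]; exact: L2.
exists (al0 :: flatten [seq L (i, v) | i <- enum D, v <- iota 0 (al0 i)]).
  move=> al; rewrite inE => /orP[/eqP -> //|/flattenP[l /allpairsPdep[i [v [iD _ ->]]]]].
  by rewrite mem_enum in iD; exact: (hL (i, v) iD).1.
move=> be Sbe; have [h|] := boolP (al0 <= be)%MM.
  by exists al0 => //; exact: mem_head.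
case/forallPn => i; rewrite -ltnNge => hi.
have iD : i \in D.
  by apply: contraLR hi => iD; rewrite (hS _ _ _ Sal0 Sbe iD) ltnn.
have [al hal le] := (hL (i, be i) iD).2 be Sbe erefl.
exists al => //; rewrite inE; apply/orP; right; apply/flattenP; exists (L (i, be i)) => //.
by apply/allpairsPdep; exists i, (be i); rewrite mem_enum mem_iota.
Qed.

Section AdditiveOrder.
Variables (n : nat) (ord : rel 'X_{1..n}).
Hypothesis Hord : additive_total_order ord.
Implicit Types al be ga : 'X_{1..n}.

Lemma ato_addr al ga : ord al (al + ga)%MM.
Proof.
have [->|h] := eqVneq ga 0%MM; first by rewrite addm0; exact: (ato_refl Hord).
have := @ato_add _ _ Hord 0%MM ga al (ato_min Hord h).
by rewrite add0m addmC => /andP[].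
Qed.

Lemma ato_leD al be ga de : ord al ga -> ord be de -> ord (al + be)%MM (ga + de)%MM.
Proof.
have leD u v w : ord u v -> ord (u + w)%MM (v + w)%MM.
  move=> h; have [->|ne] := eqVneq u v; first exact: (ato_refl Hord).
  by have /andP[] := @ato_add _ _ Hord u v w (introT andP (conj h ne)).
move=> h1 h2; apply: (ato_trans Hord) (leD _ _ _ h1) _.
by rewrite ![(ga + _)%MM]addmC; exact: leD.
Qed.

(** Additive orders extend divisibility, so the least of the finitely many members given by
    [dickson] is least in all of [S]. *)
Lemma ato_minimum (S : set 'X_{1..n}) be0 : S be0 ->
  exists2 al, S al & forall be, S be -> ord al be.
Proof.
move=> S0; have [L hL hmin] := dickson S.
suff [al hal h] : exists2 al, al \in L & forall be, be \in L -> ord al be.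
  exists al => [|be /hmin[ga /h ale gle]]; first exact: hL.
  by apply: (ato_trans Hord) ale _; rewrite -(submK gle) addmC; exact: ato_addr.
have [al0 h0 _] := hmin _ S0; elim: L al0 h0 {hL hmin} => [//|al1 L IHL] _ _.
case: L IHL => [|al2 L] IHL.
  by exists al1; rewrite ?mem_head // => be; rewrite inE => /eqP ->; exact: (ato_refl Hord).
have [al hal h] := IHL al2 (mem_head _ _).
case/orP: (ato_total Hord al al1) => le.
  exists al => [|be]; first by rewrite inE hal orbT.
  by rewrite inE => /orP[/eqP -> //|/h].
exists al1 => [|be]; first exact: mem_head.
rewrite inE => /orP[/eqP ->|/h]; first exact: (ato_refl Hord).
exact: (ato_trans Hord).
Qed.

Lemma ole_refl : reflexive (ole ord).
Proof. by case=> [al|] //; exact: (ato_refl Hord). Qed.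

Lemma omin_lel u v : ole ord (omin ord u v) u.
Proof.
rewrite /omin; case: ifP => h; first exact: ole_refl.
by case: u v h => [al|] [be|] //=; case/orP: (ato_total Hord al be) => ->.
Qed.

Lemma omin_ler u v : ole ord (omin ord u v) v.
Proof. by rewrite /omin; case: ifP => // _; exact: ole_refl. Qed.

End AdditiveOrder.

Section LeadingMonomial.
Variables (k : finFieldType) (A R : unitRingType) (io : k -> A) (x0 : seq A).
Variables (a : {rmorphism A -> R}) (n : nat) (x : n.-tuple R).
Hypothesis HS : residue_section io x0.
Hypothesis HB : graded_basis io a x.
Hypothesis Hx : exists ys, x = [seq a t | t <- x0] ++ ys :> seq R.
Variable ord : rel 'X_{1..n}.
Hypothesis Hord : additive_total_order ord.
Implicit Types (al be : 'X_{1..n}) (c d : 'X_{1..n} -> k) (r s : R).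

Local Notation LM := (leading_monomial ord (supp io a x)).
Local Notation digits c r := (digits io a x c r).
Local Notation span U := (closed_span a x U).

Definition upset_ge al : set 'X_{1..n} := fun be => ord al be.
Definition upset_gt al : set 'X_{1..n} := fun be => ord al be && (al != be).

Lemma LM_digits c r : digits c r -> r != 0 -> exists al,
  [/\ LM r = Some al, c al != 0 & forall be, c be != 0 -> ord al be].
Proof.
move=> hc r0; rewrite /leading_monomial (negbTE r0).
have [be0 h0] : exists be, c be != 0.
  apply: contrapT => /forallNP h; case/negP: r0; apply/eqP.
  by apply: (digits_eq0 HS HB hc) => al; apply/eqP/negPn/negP; exact: h.
have [al hal hmin] := ato_minimum Hord (S := fun be => c be != 0) h0.
set P := (X in xget _ X); case: xgetP => [al' _ [h1 h2]|/(_ al)].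
  exists al'; split=> // [|be /(digits_supp HS HB be hc)]; last exact: h2.
  exact/(digits_supp HS HB _ hc).
by case; split=> [|be /(digits_supp HS HB be hc)/hmin//]; exact/(digits_supp HS HB _ hc).
Qed.

Lemma LM_zero : LM 0 = None.
Proof. by rewrite /leading_monomial eqxx. Qed.

Lemma LM_eq0 r : LM r = None <-> r = 0.
Proof.
split=> [|->]; last exact: LM_zero.
by rewrite /leading_monomial; case: eqP.
Qed.

Lemma upset_ge_up al be i : upset_ge al be -> upset_ge al (be + U_(i))%MM.
Proof. by move=> h; apply: (ato_trans Hord) h _; exact: ato_addr. Qed.

Lemma upset_gt_up al be i : upset_gt al be -> upset_gt al (be + U_(i))%MM.
Proof.
move=> /andP[h ne]; apply/andP; split; first exact: upset_ge_up.
apply: contraNneq ne => e; apply/eqP/(ato_anti Hord); rewrite h /= e.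
exact: ato_addr.
Qed.

Lemma LM_ge_digits al c r : digits c r ->
  ole ord (Some al) (LM r) <-> forall be, c be != 0 -> ord al be.
Proof.
move=> hc; have [r0|r0] := eqVneq r 0.
  rewrite r0 LM_zero; split=> // _ be; rewrite r0 in hc.
  by rewrite (digits_inj HS HB hc (digits_zero HS HB)) eqxx.
have [m [-> cm hm]] := LM_digits hc r0; split=> [h be /hm|]; last exact.
exact: (ato_trans Hord).
Qed.

Lemma LM_gt_digits al c r : digits c r ->
  olt ord (Some al) (LM r) <-> forall be, c be != 0 -> ord al be && (al != be).
Proof.
move=> hc; have [r0|r0] := eqVneq r 0.
  rewrite r0 LM_zero; split=> // _ be; rewrite r0 in hc.
  by rewrite (digits_inj HS HB hc (digits_zero HS HB)) eqxx.
have [m [-> cm hm]] := LM_digits hc r0; split=> [/andP[/= h ne] be /hm hbe|/(_ m cm)//].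
rewrite (ato_trans Hord h hbe) /=; apply: contraNneq ne => e.
by apply/eqP; congr Some; apply: (ato_anti Hord); rewrite h e hbe.
Qed.

Lemma LM_ge al r : ole ord (Some al) (LM r) <-> span (upset_ge al) r.
Proof.
have [c hc] := digits_exist HS HB r; rewrite LM_ge_digits //; split=> h.
  exact: (digits_closed_span HS hc).
exact: (closed_span_digits HS HB Hx (@upset_ge_up al) hc).
Qed.

Lemma LM_gt al r : olt ord (Some al) (LM r) <-> span (upset_gt al) r.
Proof.
have [c hc] := digits_exist HS HB r; rewrite LM_gt_digits //; split=> h.
  exact: (digits_closed_span HS hc).
exact: (closed_span_digits HS HB Hx (@upset_gt_up al) hc).
Qed.

Hypothesis Hmul : forall al be, LM (mon x al * mon x be) = Some (al + be)%MM.

Lemma LM_filtration : ring_filtration ord LM.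
Proof.
(* The bound u may be infinity, namely as the minimum of two infinite values; that case is settled
   apart, and the finite one by spans. *)
have GB u r s : ole ord u (LM r) -> ole ord u (LM s) -> ole ord u (LM (r - s)).
  case: u => [al|]; first by move=> /LM_ge h /LM_ge h'; exact/LM_ge/(closed_span_sub HB).
  case E: (LM r) => //; case E': (LM s) => // _ _.
  by move: E E' => /LM_eq0 -> /LM_eq0 ->; rewrite subrr LM_zero.
split.
- move=> r s; have -> : r + s = r - (0 - s) by rewrite sub0r opprK.
  apply: (GB) => //; first exact: omin_lel.
  by apply: GB; [rewrite LM_zero; case: (omin _ _ _)|exact: omin_ler].
- by move=> r s; apply: GB; [exact: omin_lel|exact: omin_ler].
- move=> r s; case Er: (LM r) => [al|]; last first.
    by move: Er => /LM_eq0 ->; rewrite mul0r LM_zero.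
  case Es: (LM s) => [be|]; last by move: Es => /LM_eq0 ->; rewrite mulr0 LM_zero.
  apply/LM_ge; apply: (closed_spanM HB (U := upset_ge al) (V := upset_ge be)).
  + by move=> ga de h1 h2; apply/LM_ge; rewrite Hmul; exact: ato_leD.
  + by apply/LM_ge; rewrite Er; exact: ole_refl.
  + by apply/LM_ge; rewrite Es; exact: ole_refl.
- exact: LM_eq0.
Qed.

End LeadingMonomial.

(** * Quantum affine spaces *)

Lemma quot_ring_lift (T T' : pzRingType) (I : set T) (HI : two_sided_ideal I)
    (phi : {rmorphism T -> T'}) : (forall t, I t -> phi t = 0) ->
  exists psi : {rmorphism quot_ring HI -> T'}, forall t, psi (quot_pi HI t) = phi t.
Proof.
move=> h; pose f (u : quot_ring HI) : T' := phi (repr u).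
have fE t : f (quot_pi HI t) = phi t.
  by apply/eqP; rewrite -subr_eq0 -rmorphB; apply/eqP/h; exact: quot_repr.
have fB : zmod_morphism f.
  move=> u v; rewrite -[u]quot_piK -[v]quot_piK.
  by rewrite -rmorphB !fE rmorphB.
have fM : monoid_morphism f.
  split=> [|u v]; first by rewrite -(rmorph1 (quot_pi HI)) fE rmorph1.
  rewrite -[u]quot_piK -[v]quot_piK.
  by rewrite -rmorphM !fE rmorphM.
pose aM := GRing.isZmodMorphism.Build _ _ f fB.
pose mM := GRing.isMonoidMorphism.Build _ _ f fM.
pose F : {rmorphism quot_ring HI -> T'} := HB.pack f aM mM.
by exists F.
Qed.

(** * The free algebra and its universal property *)

Section FreeAlgebra.
Import monalg.

Section WordEval.
Variables (n : nat) (S : nzRingType) (y : 'I_n -> S).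

Definition word_eval (w : fmonom 'I_n) : S := \prod_(i <- fmonom_val w) y i.

Lemma word_eval_is_multiplicative : mmorphism word_eval.
Proof.
split=> [v w|]; rewrite /word_eval; last by rewrite fm1 big_nil.
by rewrite fmM big_cat.
Qed.

HB.instance Definition _ := isMultiplicative.Build
  (fmonom 'I_n) S word_eval word_eval_is_multiplicative.

End WordEval.

Definition free_const (k : fieldType) n (c : k) : free_alg k n := malgC c.

Lemma free_alg_lift (k : fieldType) n (T : pzRingType) (sc : {rmorphism k -> T})
    (y : 'I_n -> T) : (forall c i, sc c * y i = y i * sc c) ->
  exists phi : {rmorphism free_alg k n -> T},
    (forall c, phi (free_const n c) = sc c) /\ forall i, phi (free_var k i) = y i.
Proof.
(* The evaluation map [mmap] is applied with a nonzero target ring, so the zero ring is treated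
   first and [T] is repacked afterwards. *)
move=> hcomm; have [T0|T1] := eqVneq (1 : T) 0.
  have eq0 (t u : T) : t = u by rewrite -[t]mul1r -[u]mul1r T0 !mul0r.
  pose f (_ : free_alg k n) : T := 0.
  have fB : zmod_morphism f by move=> u v; exact: eq0.
  have fM : monoid_morphism f by split=> [|u v]; exact: eq0.
  pose aM := GRing.isZmodMorphism.Build _ _ f fB.
  pose mM := GRing.isMonoidMorphism.Build _ _ f fM.
  pose F : {rmorphism free_alg k n -> T} := HB.pack f aM mM.
  by exists F; split=> [c|i]; exact: eq0.
pose nzM := GRing.PzSemiRing_isNonZero.Build T T1.
pose S : nzRingType := HB.pack (GRing.PzRing.sort T) nzM.
pose sc' : {rmorphism k -> S} := sc.
pose y' : 'I_n -> S := y.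
pose f : malg (fmonom 'I_n) k -> S := mmap sc' (word_eval y').
have fM : multiplicative f.
  apply: commr_mmap_is_multiplicative => g m m'.
  apply: commr_prod => i _; exact: hcomm.
have fB : additive f by exact: mmap_is_additive.
pose f' : free_alg k n -> T := f.
pose aM := GRing.isZmodMorphism.Build (free_alg k n) T f' fB.
pose mM := GRing.isMonoidMorphism.Build (free_alg k n) T f' (conj fM.2 fM.1).
pose F : {rmorphism free_alg k n -> T} := HB.pack f' aM mM.
exists F; split=> [c|i]; first exact: (@mmapC _ _ _ sc' (word_eval y') c).
rewrite /F /= /f' /f /free_var mmapU.
transitivity (1 * word_eval y' (fmu i)); first by congr (_ * _); exact: (rmorph1 sc).
rewrite mul1r.
by rewrite /word_eval fmuE /= big_seq1.
Qed.

Lemma free_monomialM (k : fieldType) n (u v : k) (w w' : fmonom 'I_n) :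
  (<< u *g w >> : free_alg k n) * << v *g w' >> = << u * v *g mmul w w' >>.
Proof.
by rewrite [LHS](malgMEw msuppU_le msuppU_le) !finmap.big_seq_fset1 !mcoeffUU.
Qed.

Section FreeConst.
Variables (k : fieldType) (n : nat).

Lemma free_const_is_zmod_morphism : zmod_morphism (@free_const k n).
Proof. by move=> c d; exact: monalgUB. Qed.

Lemma free_const_is_monoid_morphism : monoid_morphism (@free_const k n).
Proof. by split=> [//|c d]; rewrite [RHS]free_monomialM mul1m. Qed.

HB.instance Definition _ := GRing.isZmodMorphism.Build k (free_alg k n)
  (@free_const k n) free_const_is_zmod_morphism.
HB.instance Definition _ := GRing.isMonoidMorphism.Build k (free_alg k n)
  (@free_const k n) free_const_is_monoid_morphism.

End FreeConst.

Lemma free_constZ (k : fieldType) n (c : k) (t : free_alg k n) :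
  c *: t = free_const n c * t.
Proof. by rewrite [RHS]mul_malgC. Qed.

Lemma free_constC (k : fieldType) n (c : k) (i : 'I_n) :
  free_const n c * free_var k i = free_var k i * free_const n c.
Proof. by rewrite [LHS]free_monomialM [RHS]free_monomialM mulr1 mul1r mul1m mulm1. Qed.

Lemma free_word (k : fieldType) n (c : k) (w : fmonom 'I_n) :
  (<< c *g w >> : free_alg k n) =
  free_const n c * \prod_(i <- fmonom_val w) free_var k i.
Proof.
have -> : \prod_(i <- fmonom_val w) free_var k i = << w >> :> free_alg k n.
  case: w => s /=; elim: s => [|i s IHs].
    by rewrite big_nil -fmoneE.
  by rewrite big_cons IHs [LHS]free_monomialM mulr1; congr << _ *g _ >>;
    rewrite [LHS]fmmulE fmuE.
by rewrite [RHS]free_monomialM mulr1 mul1m.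
Qed.

Lemma free_alg_ind (k : fieldType) n (P : free_alg k n -> Prop) :
  P 0 -> (forall u v, P u -> P v -> P (u + v)) ->
  (forall c (w : seq 'I_n), P (free_const n c * \prod_(i <- w) free_var k i)) ->
  forall t, P t.
Proof.
move=> P0 PD Pw t; rewrite (monalgE t); apply: big_ind => // w _.
by rewrite free_word.
Qed.

End FreeAlgebra.

(* C plays the role of the scalars. *)
Section OrderedMonomials.
Variables (T : pzRingType) (C : set T).
Hypotheses (C1 : C 1) (CM : forall c d, C c -> C d -> C (c * d)).

Definition ord_mon n (y : 'I_n -> T) (m : 'I_n -> nat) : T := \prod_(i < n) y i ^+ m i.

(** The variable y_i is pushed to the right past the power of the first variable at the cost of a
    scalar; the remaining variables are covered by induction. *)
Lemma mulr_ord_mon n (y : 'I_n -> T) (m : 'I_n -> nat) (i : 'I_n) :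
  (forall c j, C c -> c * y j = y j * c) ->
  (forall j l : 'I_n, (j < l)%N -> exists2 c, C c & y l * y j = c * (y j * y l)) ->
  exists2 c, C c & y i * ord_mon y m = c * ord_mon y (fun l => (m l + (i == l))%N).
Proof.
elim: n y m i => [|n IHn] y m i hC hq; first by case: i.
rewrite /ord_mon !big_ord_recl /=.
case: (unliftP ord0 i) => [j ->|->]; last first.
  exists 1 => //; rewrite mul1r eqxx addn1 exprS mulrA; congr (_ * _).
  by apply: eq_bigr => l _; rewrite addn0.
have [c hc e] : exists2 c, C c &
    y (lift ord0 j) * y ord0 ^+ m ord0 = c * (y ord0 ^+ m ord0 * y (lift ord0 j)).
  have [c hc e] : exists2 c, C c &
    y (lift ord0 j) * y ord0 = c * (y ord0 * y (lift ord0 j)) by exact: hq.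
  elim: (m ord0) => [|v [d hd ev]]; first by exists 1; rewrite ?expr0 ?mul1r ?mulr1.
  exists (c * d); first exact: CM.
  rewrite exprS mulrA e -!mulrA ev; congr (c * _).
  by rewrite !mulrA -(hC d) // mulrA.
have [c' hc' e'] := IHn (fun l => y (lift ord0 l)) (fun l => m (lift ord0 l)) j
  (fun c l => hC c (lift ord0 l))
  (fun l l' (h : (l < l')%N) => hq (lift ord0 l) (lift ord0 l') h).
exists (c * c'); first exact: CM.
rewrite mulrA e -!mulrA [y (lift ord0 j) * _]e' addn0; congr (c * _).
rewrite mulrA -(commrX (m ord0) (hC c' ord0 hc')) -mulrA; congr (_ * (_ * _)).
Qed.

Lemma ord_mon_word n (y : 'I_n -> T) (w : seq 'I_n) :
  (forall c j, C c -> c * y j = y j * c) ->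
  (forall j l : 'I_n, (j < l)%N -> exists2 c, C c & y l * y j = c * (y j * y l)) ->
  exists2 c, C c & exists m : 'X_{1..n}, \prod_(i <- w) y i = c * ord_mon y m.
Proof.
move=> hC hq; elim: w => [|i w [c hc [m e]]].
  exists 1 => //; exists 0%MM; rewrite big_nil /ord_mon big1 ?mulr1 // => i _.
  by rewrite mnm0E.
rewrite big_cons e; have [d hd ed] := mulr_ord_mon m i hC hq.
exists (c * d); first exact: CM.
exists (m + U_(i))%MM; rewrite mulrA -hC // -!mulrA ed; congr (c * (d * _)).
by apply: eq_bigr => l _; rewrite mnmDE mnm1E.
Qed.

End OrderedMonomials.

Section LowerSum.
Variables (k : fieldType) (T : pzRingType) (n : nat) (sc : {rmorphism k -> T}).
Variable y : 'I_n -> T.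
Implicit Types (c d : 'X_{1..n} -> k) (m : 'X_{1..n}).

(** Finite combinations of ordered monomials are encoded by a total coefficient function and a
    degree bound. *)
Definition lower_sum (N : nat) c : T := \sum_(m <- mnms_lt n N) sc (c m) * ord_mon y m.

Lemma lower_sum_widen N M c : (N <= M)%N ->
  lower_sum N c = lower_sum M (fun m => if (mdeg m < N)%N then c m else 0).
Proof.
move=> h; rewrite /lower_sum [RHS](bigID (fun m => (mdeg m < N)%N)) /=.
rewrite [X in _ = _ + X]big1 ?addr0 => [|m /negbTE ->]; last by rewrite rmorph0 mul0r.
rewrite -[in RHS]big_filter (perm_big [seq m <- mnms_lt n M | (mdeg m < N)%N]).
  rewrite big_seq [RHS]big_seq; apply: eq_bigr => m.
  by rewrite mem_filter => /andP[-> _].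
apply: uniq_perm; rewrite ?filter_uniq ?mnms_lt_uniq // => m.
rewrite mem_filter !mem_mnms_lt; case: ltnP => // hm.
by rewrite (leq_trans hm h).
Qed.

Lemma lower_sumD N M c d : exists K e, lower_sum N c + lower_sum M d = lower_sum K e.
Proof.
rewrite (lower_sum_widen c (leq_maxl N M)) (lower_sum_widen d (leq_maxr N M)).
exists (maxn N M); eexists (fun m => _ + _); rewrite -big_split /=.
by apply: eq_bigr => m _; rewrite rmorphD mulrDl.
Qed.

Lemma lower_sum_term u m : exists N c, sc u * ord_mon y m = lower_sum N c.
Proof.
exists (mdeg m).+1, (fun m' => if m' == m then u else 0); rewrite /lower_sum.
rewrite (bigD1_seq m) ?mnms_lt_uniq ?mem_mnms_lt //= eqxx big1 ?addr0 //.
by move=> m' /negbTE ->; rewrite rmorph0 mul0r.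
Qed.

End LowerSum.

Lemma rmorph_commutator (U V : pzRingType) (phi : {rmorphism U -> V}) (u v w : U) :
  phi (u * v - w * (v * u)) = phi u * phi v - phi w * (phi v * phi u).
Proof. by rewrite rmorphB !rmorphM. Qed.

Section QCommIso.
Variables (k : fieldType) (n : nat) (q : 'I_n -> 'I_n -> k).

Let Q := qcomm_poly q.
Let piQ : {rmorphism free_alg k n -> Q} := quot_pi (ideal_gen_ideal (qcomm_rels q)).
Let scQ : {rmorphism k -> Q} := piQ \o @free_const k n.
Let yQ (i : 'I_n) : Q := piQ (free_var k i).

Lemma qcomm_rel (i j : 'I_n) : (i < j)%N -> yQ j * yQ i = scQ (q i j) * (yQ i * yQ j).
Proof.
move=> hij.
have -> : yQ j * yQ i = piQ (free_var k j * free_var k i) by rewrite [RHS]rmorphM.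
have -> : scQ (q i j) * (yQ i * yQ j) =
    piQ (q i j *: (free_var k i * free_var k j)).
  by rewrite free_constZ [RHS]rmorphM [in RHS]rmorphM.
by apply/quot_piE => J HJ; apply; exists i, j; split.
Qed.

Lemma qcomm_span (u : Q) : exists N c, u = lower_sum scQ yQ N c.
Proof.
rewrite -[u]quot_piK; move: (repr u); apply: free_alg_ind => [|s t|c w].
- by exists 0%N, (fun _ => 0); rewrite /lower_sum big_nil rmorph0.
- move=> [N [c es]] [M [d et]]; have [K [e eK]] := lower_sumD scQ yQ N M c d.
  by exists K, e; rewrite -eK -es -et; exact: (rmorphD piQ).
(* The images of the scalars commute with the variables and absorb the q_ij that appear when a word
   is sorted. *)
pose C : set Q := fun s => exists b, s = scQ b.
have [|s t [b ->] [d ->]|s i [b ->]|i j hij|_ [b ->] [m e]] := @ord_mon_word Q C _ _ n yQ w.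
- by exists 1; rewrite rmorph1.
- by exists (b * d); rewrite rmorphM.
- transitivity (piQ (free_const n b * free_var k i)); first by rewrite [RHS]rmorphM.
  by rewrite free_constC [LHS]rmorphM.
- by exists (scQ (q i j)); [exists (q i j)|exact: qcomm_rel].
set s := \prod_(i <- w) _.
have -> : quot_pi (ideal_gen_ideal (qcomm_rels q)) (free_const n c * s) =
    scQ (c * b) * ord_mon yQ m.
  transitivity (piQ (free_const n c) * piQ s); first exact: (rmorphM piQ).
  transitivity (scQ c * (scQ b * ord_mon yQ m)); last first.
    have scM : scQ (c * b) = scQ c * scQ b := rmorphM scQ c b.
    rewrite scM.
    exact: mulrA.
  by congr (_ * _); rewrite -e; exact: (rmorph_prod piQ).
exact: lower_sum_term.
Qed.

(** A presentation yields maps out of [Q], so the isomorphism onto [Q] is obtained as the inverse of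
    such a map. *)
Lemma qcomm_iso (T : pzRingType) (sc : {rmorphism k -> T}) (y : 'I_n -> T) :
  (forall c i, sc c * y i = y i * sc c) ->
  (forall i j : 'I_n, (i < j)%N -> y j * y i = sc (q i j) * (y i * y j)) ->
  (forall N c, lower_sum sc y N c = 0 ->
     forall m : 'X_{1..n}, (mdeg m < N)%N -> c m = 0) ->
  (forall t, exists N c, t = lower_sum sc y N c) ->
  exists f : {rmorphism T -> Q}, bijective f.
Proof.
move=> hC hq hinj hsur; have [phi [phic phiv]] := free_alg_lift hC.
have [|psi hpsi] := @quot_ring_lift _ _ _ (ideal_gen_ideal (qcomm_rels q)) phi.
  (* [ideal_gen] is an intersection, so it suffices that the kernel of [phi] is an ideal containing
     the relations. *)
  move=> t /(_ (fun t => phi t = 0)); apply.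
    split=> [|u v eu ev|u v ev|u v ev]; first exact: rmorph0.
    - by rewrite rmorphB eu ev subrr.
    - by rewrite rmorphM ev mulr0.
    - by rewrite rmorphM ev mul0r.
  move=> _ [i [j [hij ->]]].
  by rewrite free_constZ rmorph_commutator !phiv phic hq // subrr.
have psiE N c : psi (lower_sum scQ yQ N c) = lower_sum sc y N c.
  rewrite rmorph_sum; apply: eq_bigr => m _; rewrite rmorphM hpsi phic; congr (_ * _).
  by rewrite rmorph_prod; apply: eq_bigr => i _; rewrite rmorphXn hpsi phiv.
have psi0 u : psi u = 0 -> u = 0.
  have [N [c ->]] := qcomm_span u; rewrite psiE => /hinj h.
  rewrite /lower_sum big_seq big1 // => m; rewrite mem_mnms_lt => /h ->.
  by rewrite rmorph0 mul0r.
have /choice[g gK] : forall t, exists u, psi u = t.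
  by move=> t; have [N [c ->]] := hsur t; exists (lower_sum scQ yQ N c).
have psiK : cancel psi g.
  by move=> u; apply/eqP; rewrite -subr_eq0; apply/eqP/psi0; rewrite rmorphB gK subrr.
pose aM := GRing.isZmodMorphism.Build _ _ g (can2_zmod_morphism psiK gK).
pose mM := GRing.isMonoidMorphism.Build _ _ g (can2_monoid_morphism psiK gK).
pose f : {rmorphism T -> Q} := HB.pack g aM mM.
by exists f; exists psi.
Qed.

End QCommIso.

(** * The associated graded ring *)

Lemma mon_U (R : nzRingType) n (x : n.-tuple R) i : mon x U_(i)%MM = tnth x i.
Proof. exact: (mmap1U (tnth x) i). Qed.

Lemma mon_UD (R : nzRingType) n (x : n.-tuple R) (i j : 'I_n) : (i < j)%N ->
  mon x (U_(i) + U_(j))%MM = tnth x i * tnth x j.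
Proof.
(* Two ordered monomials multiply to an ordered one if no variable of the second has to move past a
   later variable of the first. *)
have h m (y : 'I_m -> R) (e f : 'I_m -> nat) :
    (forall l l' : 'I_m, (l < l')%N -> f l = 0%N \/ e l' = 0%N) ->
    \prod_(l < m) y l ^+ (e l + f l) =
      (\prod_(l < m) y l ^+ e l) * \prod_(l < m) y l ^+ f l.
  elim: m y e f => [|m IHm] y e f hef; first by rewrite !big_ord0 mulr1.
  rewrite !big_ord_recl IHm => [|l l' hl]; last by apply: hef.
  rewrite exprD -!mulrA; congr (_ * _); rewrite !mulrA; congr (_ * _).
  have [->|f0] := eqVneq (f ord0) 0%N; first by rewrite expr0 mul1r mulr1.
  rewrite big1 ?mul1r ?mulr1 // => l _.
  by case: (hef ord0 (lift ord0 l)) => // [e0|->//]; rewrite e0 eqxx in f0.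
move=> hij; rewrite -[in RHS](mon_U x i) -[in RHS](mon_U x j) /mon -h => [|l l' hl].
  by apply: eq_bigr => l _; rewrite mnmDE.
rewrite !mnm1E; have [e|_] := eqVneq j l; last by left.
have [e'|_] := eqVneq i l'; last by right.
by move: hl; rewrite -e -e' ltnNge (ltnW hij).
Qed.

(** * Homogeneous classes in the ring of a graded family *)

Section GradedFamily.
Variables (R : nzRingType) (n : nat) (F Fp : 'X_{1..n} -> set R).
Hypothesis HF : graded_family F Fp.
Implicit Types (al be : 'X_{1..n}) (r s : R).

Let Gr := gr_of_family HF.
Let piG : {rmorphism rees_ring HF -> Gr} := quot_pi (rees_ideal_ideal HF).

(** The default 0 makes this total; it has the intended value when r lies in F_al, whence that
    hypothesis below. *)
Definition rees_term al r : rees_ring HF := insubd 0 (r *: 'X_[al]).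

Lemma graded_family0 al : F al 0.
Proof. exact/(gf_sub HF)/(gf0 HF). Qed.

Lemma graded_familyD al r s : F al r -> F al s -> F al (r + s).
Proof.
move=> hr hs; rewrite -[s]opprK -[- s]sub0r; apply: (gfB HF) => //.
by apply: (gfB HF) => //; exact: graded_family0.
Qed.

Lemma rees_termE al r : F al r -> rees_val (rees_term al r) = r *: 'X_[al].
Proof.
move=> h; rewrite -[LHS]/(val _) insubdK //; apply/asboolP => be.
rewrite mcoeffZ mcoeffX; case: eqP => [<-|_]; first by rewrite mulr1.
by rewrite mulr0; apply/(gf_sub HF)/(gf0 HF).
Qed.

Lemma rees_valD (f g : rees_ring HF) : rees_val (f + g) = rees_val f + rees_val g.
Proof. exact: (raddfD (val : rees_ring HF -> _)). Qed.

Lemma rees_valB (f g : rees_ring HF) : rees_val (f - g) = rees_val f - rees_val g.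
Proof. exact: (raddfB (val : rees_ring HF -> _)). Qed.

Lemma rees_valM (f g : rees_ring HF) : rees_val (f * g) = rees_val f * rees_val g.
Proof. exact: (rmorphM (val : rees_ring HF -> _)). Qed.

Lemma rees_val_sum (K : Type) (l : seq K) (f : K -> rees_ring HF) :
  rees_val (\sum_(i <- l) f i) = \sum_(i <- l) rees_val (f i).
Proof. exact: (raddf_sum (val : rees_ring HF -> _)). Qed.

Definition cls al r : Gr := piG (rees_term al r).

Lemma cls_eq al r s : F al r -> F al s -> Fp al (r - s) -> cls al r = cls al s.
Proof.
move=> hr hs h; apply/quot_piE => be; rewrite rees_valB.
rewrite (rees_termE hr) (rees_termE hs) -scalerBl.
rewrite mcoeffZ mcoeffX; case: eqP => [<-|_]; first by rewrite mulr1.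
by rewrite mulr0; exact: (gf0 HF).
Qed.

Lemma clsD al r s : F al r -> F al s -> cls al (r + s) = cls al r + cls al s.
Proof.
move=> hr hs; rewrite /cls; transitivity (piG (rees_term al r + rees_term al s)).
  congr (piG _); apply: val_inj.
  rewrite -[LHS]/(rees_val _) -[RHS]/(rees_val (rees_term al r + rees_term al s)).
  rewrite rees_valD (rees_termE hr) (rees_termE hs).
  by rewrite (rees_termE (graded_familyD hr hs)) scalerDl.
exact: rmorphD.
Qed.

Lemma clsM al be r s : F al r -> F be s ->
  cls (al + be)%MM (r * s) = cls al r * cls be s.
Proof.
move=> hr hs; rewrite /cls; transitivity (piG (rees_term al r * rees_term be s)).
  congr (piG _); apply: val_inj.
  rewrite -[LHS]/(rees_val _) -[RHS]/(rees_val (rees_term al r * rees_term be s)).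
  rewrite rees_valM (rees_termE hr) (rees_termE hs) (rees_termE (gfM HF hr hs)).
  have comm : 'X_[al] * (s *: 'X_[be]) = (s *: 'X_[be]) * 'X_[al] :> {mpoly R[n]}.
    exact/esym/commr_mpolyX.
  by rewrite -scalerAl comm -scalerAl -mpolyXD scalerA [(be + al)%MM]addmC.
exact: rmorphM.
Qed.

Lemma cls1 : cls 0%MM 1 = 1.
Proof.
rewrite /cls; transitivity (piG 1); last exact: rmorph1.
congr (piG _); apply: val_inj; rewrite -[LHS]/(rees_val _) rees_termE; last exact: (gf1 HF).
by rewrite mpolyX0 scale1r -(rmorph1 (val : rees_ring HF -> _)).
Qed.

Lemma ord_mon_cls (y : 'I_n -> R) al : (forall i, F U_(i)%MM (y i)) ->
  ord_mon (fun i => cls U_(i)%MM (y i)) al = cls al (ord_mon y al).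
Proof.
move=> hy.
(* Membership is proved along with the identity because [clsM] needs it at the next step. *)
have hX i e : cls U_(i)%MM (y i) ^+ e = cls (U_(i) *+ e)%MM (y i ^+ e) /\
    F (U_(i) *+ e)%MM (y i ^+ e).
  elim: e => [|e [IH1 IH2]].
    by rewrite mulm0n !expr0 cls1; split=> //; exact: (gf1 HF).
  rewrite mulmS !exprS IH1 (clsM (hy i) IH2).
  by split=> //; exact: (gfM HF).
rewrite [al in cls al _]multinomUE_id /ord_mon.
suff h (l : seq 'I_n) : \prod_(i <- l) cls U_(i)%MM (y i) ^+ al i =
    cls (\sum_(i <- l) U_(i) *+ al i)%MM (\prod_(i <- l) y i ^+ al i) /\
  F (\sum_(i <- l) U_(i) *+ al i)%MM (\prod_(i <- l) y i ^+ al i).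
  exact: (h _).1.
elim: l => [|i l [IH1 IH2]].
  by rewrite !big_nil cls1; split=> //; exact: (gf1 HF).
have [h1 h2] := hX i (al i); rewrite !big_cons h1 IH1 (clsM h2 IH2).
by split=> //; exact: (gfM HF).
Qed.

Lemma sum_rees_termE (l : seq 'X_{1..n}) (r : 'X_{1..n} -> R) al : uniq l ->
  (forall m, F m (r m)) ->
  (rees_val (\sum_(m <- l) rees_term m (r m)))@_al = if al \in l then r al else 0.
Proof.
move=> ul hr; rewrite rees_val_sum (eq_bigr (fun m => r m *: 'X_[m])); last first.
  by move=> m _; exact: rees_termE.
rewrite raddf_sum /=; under eq_bigr => m _ do rewrite mcoeffZ mcoeffX.
case: ifP => h.
  rewrite (bigD1_seq al) //= eqxx mulr1 big1 ?addr0 //.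
  by move=> m /negbTE ->; rewrite mulr0.
rewrite big_seq big1 // => m hm.
by case: eqP h => [<-|_ _]; rewrite ?mulr0 // hm.
Qed.

(** The sum of the graded pieces is direct, since distinct degrees sit at distinct monomials of the
    polynomial ring. *)
Lemma sum_cls_eq0 (l : seq 'X_{1..n}) (r : 'X_{1..n} -> R) : uniq l ->
  (forall m, F m (r m)) -> \sum_(m <- l) cls m (r m) = 0 ->
  forall al, al \in l -> Fp al (r al).
Proof.
move=> ul hr h al hal; have e : piG (\sum_(m <- l) rees_term m (r m)) = piG 0.
  by rewrite rmorph0 -[RHS]h; exact: rmorph_sum.
by move/quot_piE: e => /(_ al); rewrite subr0 sum_rees_termE // hal.
Qed.

(** The representatives r are left free modulo F_al^+, so that each component can later be replaced
    by its leading term. *)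
Lemma gr_of_family_span (t : Gr) : exists N, exists2 f : 'X_{1..n} -> R,
  (forall m, F m (f m)) &
  forall r : 'X_{1..n} -> R, (forall m, F m (r m)) -> (forall m, Fp m (f m - r m)) ->
    t = \sum_(m <- mnms_lt n N) cls m (r m).
Proof.
rewrite -[t]quot_piK; set f := repr t; exists (msize (rees_val f)).
exists (fun m => (rees_val f)@_m) => [m|r hr hfr]; first by case: f => f /= /asboolP.
transitivity (piG (\sum_(m <- mnms_lt n (msize (rees_val f))) rees_term m (r m))).
  apply/quot_piE => m; rewrite rees_valB mcoeffB sum_rees_termE ?mnms_lt_uniq //.
  rewrite mem_mnms_lt; case: ltnP => hm //.
  rewrite subr0 memN_msupp_eq0; first exact: (gf0 HF).
  by apply/negP => /msize_mdeg_lt; rewrite ltnNge hm.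
exact: rmorph_sum.
Qed.

End GradedFamily.

(** * The graded ring of the leading monomial filtration *)

Section Graded.
Variables (k : finFieldType) (A R : unitRingType) (io : k -> A) (x0 : seq A).
Variables (a : {rmorphism A -> R}) (n : nat) (x : n.-tuple R).
Hypothesis HS : residue_section io x0.
Hypothesis HB : graded_basis io a x.
Hypothesis Hx : exists ys, x = [seq a t | t <- x0] ++ ys :> seq R.
Variable ord : rel 'X_{1..n}.
Hypothesis Hord : additive_total_order ord.
Implicit Types (al be : 'X_{1..n}) (c d : 'X_{1..n} -> k) (r s : R).

Local Notation LM := (leading_monomial ord (supp io a x)).
Local Notation digits c r := (digits io a x c r).
Local Notation F := (ideal_pow (@max_ideal R)).
Local Notation fge := (fil_ge ord LM).
Local Notation fgt := (fil_gt ord LM).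
Hypothesis Hmul : forall al be, LM (mon x al * mon x be) = Some (al + be)%MM.
Hypothesis HLM : ring_filtration ord LM.

Let HF := ideal_pow_ideal (gb_ideal HB).

Lemma LM_mon al : LM (mon x al) = Some al.
Proof. by rewrite -[mon x al]mulr1 -(mon0 x) Hmul addm0. Qed.

Lemma fil_ge0 r : fge 0%MM r.
Proof.
rewrite /fil_ge /=; case: (LM r) => // al.
by have := ato_addr Hord 0%MM al; rewrite add0m.
Qed.

Lemma fil_ge_term u al : fge al (a u * mon x al).
Proof.
apply/(LM_ge HS HB Hx Hord)/(closed_span_scale HB)/(LM_ge HS HB Hx Hord).
by rewrite LM_mon; exact: ole_refl.
Qed.

Lemma fil_gt_carry u al : max_ideal u -> fgt al (a u * mon x al).
Proof.
move=> /(carry HS HB Hx al)[->|[i [v ->]]].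
  by rewrite /fil_gt /= LM_zero.
apply/(LM_gt HS HB Hx Hord)/(closed_span_scale HB)/(LM_gt HS HB Hx Hord).
rewrite LM_mon; apply/andP; split; first exact: ato_addr.
apply/eqP => -[] /(congr1 (@mdeg n)) /eqP.
by rewrite mdegD mdeg1 -{1}[mdeg al]addn0 eqn_add2l.
Qed.

(** Each graded piece is spanned by the class of x^al: modulo larger exponents only the digit at al
    remains. *)
Lemma fil_gt_digit c r al : digits c r -> fge al r ->
  fgt al (r - a (io (c al)) * mon x al).
Proof.
(* Subtracting a digit at its own place causes no carry, so the digits of the difference are those
   of r with this one erased. *)
move=> hc hr; pose c' be := if be == al then 0 else c be.
have hc' : digits c' (r - a (io (c al)) * mon x al).
  move=> N; have := hc N; case: (ltnP (mdeg al) N) => h.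
    suff -> : psum io a x c N = a (io (c al)) * mon x al + psum io a x c' N.
      by rewrite opprD addrA.
    have hin : al \in mnms_lt n N by rewrite mem_mnms_lt.
    rewrite /psum !(bigD1_seq al hin (mnms_lt_uniq n N)) /= /c' eqxx (g0 a HS).
    rewrite mul0r add0r; congr (_ + _).
    by apply: eq_bigr => be /negbTE ->.
  rewrite -(@eq_psum _ _ _ io a n x c' c) => [hN|be hbe]; last first.
    by rewrite /c'; case: eqP hbe => // ->; rewrite ltnNge h.
  rewrite addrAC; apply: (tsiB (HF N)) => //.
  exact: (term_ideal_pow HB).
apply/(LM_gt_digits HS HB Hord al hc') => be; rewrite /c'.
have [_|ne hbe] := eqVneq be al; first by rewrite eqxx.
rewrite andbT.
exact: (LM_ge_digits HS HB Hord al hc).1.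
Qed.

Let fam := filtration_family Hord HLM.
Let Gr := gr_of_family fam.
Local Notation cl := (cls fam).

(** A ring map although [io] is not additive: the defect lies in the maximal ideal of [A], hence
    above exponent 0 by [fil_gt_carry]. *)
Definition gr_const (u : k) : Gr := cl 0%MM (a (io u)).

Definition gr_var (i : 'I_n) : Gr := cl U_(i)%MM (tnth x i).

Lemma gr_constD u v : gr_const (u + v) = gr_const u + gr_const v.
Proof.
rewrite /gr_const -(clsD fam (fil_ge0 _) (fil_ge0 _)).
apply: (cls_eq fam (fil_ge0 _) (fil_ge0 _)).
rewrite -opprB -sub0r; apply: (gfpB fam); first exact: (gf0 fam).
rewrite -rmorphD -rmorphB -[a _]mulr1 -(mon0 x).
by apply: fil_gt_carry; exact: (rsD HS).
Qed.

Lemma gr_constM u v : gr_const (u * v) = gr_const u * gr_const v.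
Proof.
by rewrite /gr_const -(clsM fam (fil_ge0 _) (fil_ge0 _)) addm0 (rsM HS) rmorphM.
Qed.

Lemma gr_const1 : gr_const 1 = 1.
Proof. by rewrite /gr_const (g1 a HS) cls1. Qed.

Lemma fil_ge_mon al : fge al (mon x al).
Proof. by rewrite /fil_ge /= LM_mon; exact: (ato_refl Hord). Qed.

Lemma fil_ge_var i : fge U_(i)%MM (tnth x i).
Proof. by rewrite -mon_U; exact: fil_ge_mon. Qed.

Lemma gr_const_var u i : gr_const u * gr_var i = gr_var i * gr_const u.
Proof.
have h0 := fil_ge0 (a (io u)); have hi := fil_ge_var i.
apply: etrans (esym (clsM fam h0 hi)) (etrans _ (clsM fam hi h0)).
by rewrite addmC (gb_central HB).
Qed.

Lemma gr_term u al : gr_const u * ord_mon gr_var al = cl al (a (io u) * mon x al).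
Proof.
have -> : ord_mon gr_var al = cl al (mon x al) by exact: (ord_mon_cls fam al fil_ge_var).
by rewrite /gr_const -(clsM fam (fil_ge0 _) (fil_ge_mon al)) add0m.
Qed.

Lemma gr_var_commute (i j : 'I_n) c : (i < j)%N -> digits c (tnth x j * tnth x i) ->
  gr_var j * gr_var i = gr_const (c (U_(i) + U_(j))%MM) * (gr_var i * gr_var j).
Proof.
move=> hij hc; have hi := fil_ge_var i; have hj := fil_ge_var j.
have hji : fge (U_(i) + U_(j))%MM (tnth x j * tnth x i).
  by rewrite addmC; exact: (gfM fam hj hi).
have e : gr_var i * gr_var j = ord_mon gr_var (U_(i) + U_(j))%MM.
  apply: etrans (esym (clsM fam hi hj)) _.
  apply: etrans _ (esym (ord_mon_cls fam _ fil_ge_var)).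
  by congr (cl _ _); apply/esym; exact: mon_UD.
apply: etrans (esym (clsM fam hj hi)) _.
transitivity (gr_const (c (U_(i) + U_(j))%MM) * ord_mon gr_var (U_(i) + U_(j))%MM);
  last by congr (_ * _); exact/esym.
rewrite gr_term.
rewrite [(U_(j) + _)%MM]addmC.
exact: (cls_eq fam hji (fil_ge_term _ _) (fil_gt_digit hc hji)).
Qed.

Lemma assoc_graded_iso : exists q : 'I_n -> 'I_n -> k,
  (forall i j : 'I_n, (i < j)%N -> q i j != 0) /\
  exists f : {rmorphism Gr -> qcomm_poly q}, bijective f.
Proof.
have /choice[dig hdig] : forall r, exists c, digits c r := digits_exist HS HB.
pose q (i j : 'I_n) := dig (tnth x j * tnth x i) (U_(i) + U_(j))%MM.
have sc0 : gr_const 0 = 0 by apply: (addrI (gr_const 0)); rewrite -gr_constD !addr0.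
have scN u : gr_const (- u) = - gr_const u.
  by apply/eqP; rewrite -addr_eq0 -gr_constD addNr sc0.
have scB : zmod_morphism gr_const by move=> u v; rewrite gr_constD scN.
have scM : monoid_morphism gr_const by split; [exact: gr_const1|exact: gr_constM].
pose aM := GRing.isZmodMorphism.Build _ _ gr_const scB.
pose mM := GRing.isMonoidMorphism.Build _ _ gr_const scM.
pose sc : {rmorphism k -> Gr} := HB.pack gr_const aM mM.
exists q; split=> [i j hij|].
  have r0 : tnth x j * tnth x i != 0.
    apply/eqP => r0; have := Hmul U_(j)%MM U_(i)%MM.
    by rewrite !mon_U r0 LM_zero.
  have [al [e h _]] := LM_digits HS HB Hord (hdig (tnth x j * tnth x i)) r0.
  by move: e h; rewrite -!mon_U Hmul addmC !mon_U => -[<-].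
apply: (@qcomm_iso _ _ q _ sc gr_var).
- exact: gr_const_var.
- by move=> i j hij; exact: gr_var_commute.
- move=> N c h m hm; apply/eqP/negPn/negP => cm.
  have e : \sum_(m <- mnms_lt n N) cl m (a (io (c m)) * mon x m) = 0.
    by rewrite -[RHS]h; apply: eq_bigr => m' _; rewrite -gr_term.
  have hin : m \in mnms_lt n N by rewrite mem_mnms_lt.
  (* A nonzero digit at m gives a term with leading monomial exactly m, whereas a vanishing class
     would require a larger one. *)
  have := sum_cls_eq0 (mnms_lt_uniq n N) (fun m => fil_ge_term _ m) e hin.
  move=> /(LM_gt_digits HS HB Hord m (digits_term HS HB (c m) m))/(_ m).
  by rewrite !eqxx andbF => /(_ cm).
- move=> t; have [N [f hf ht]] := gr_of_family_span t.
  (* The component in degree m is determined by the digit of [f m] at m, the rest of [f m] lying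
     strictly above m. *)
  exists N, (fun m => dig (f m) m).
  rewrite (ht (fun m => a (io (dig (f m) m)) * mon x m)).
  + by apply: eq_bigr => m _; rewrite -gr_term.
  + by move=> m; exact: fil_ge_term.
  + by move=> m; exact: fil_gt_digit.
Qed.

End Graded.

Theorem corollary4p16 (p n : nat) (k : finFieldType) (A R : unitRingType)
    (iota : k -> A) (x0 : seq A) (a : {rmorphism A -> R})
    (subs : seq (set R)) (x : n.-tuple R)
    (hA : coefficient_ring p iota x0)
    (hR : iterated_skew x0 a subs x)
    (ord : rel 'X_{1..n})
    (hord : monomial_order x (supp iota a x) ord)
    (htri : triangular_order ord) :
  exists H : ring_filtration ord (leading_monomial ord (supp iota a x)),
  exists q : 'I_n -> 'I_n -> k,
    (forall i j : 'I_n, (i < j)%N -> q i j != 0) /\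
    exists f : {rmorphism assoc_graded (mo_order hord) H -> qcomm_poly q},
      bijective f.
Proof.
have [HS H0] := coefficient_ring_basis hA.
have [HB Hx] := iterated_skew_basis H0 hR.
exists (LM_filtration HS HB Hx (mo_order hord) (mo_mul hord)).
exact: (assoc_graded_iso HS HB Hx (mo_order hord) (mo_mul hord)).
Qed.
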